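(* Assume $\dot x=A(t)x$ has a nonuniform exponential dichotomy on $\mathbb{R}_0^+$ with constants $(K,\alpha,\mu)$ and projector $P(\cdot)$ and nonuniform bounded growth with constants $(K_0,a,\varepsilon)$; assume $f$ satisfies (P1) with $(L_f,\theta)$, (P2) with $(M,\delta)$ and (P3); let $b>0$ be such that $$\delta+\mu<\min\{b,\alpha\};\quad \mu\le\theta,\ \varepsilon<\theta,\ \alpha+\mu-\theta+b>0,\ \alpha-\mu+\theta-b>0;\quad \frac{KL_f}{\alpha+\mu-\theta+b}+\frac{KL_f}{\alpha-\mu+\theta-b}<1.$$ Assume in addition that $$\max\{\mu+\alpha-a,\ \mu-(\alpha-a)\}<\theta,\qquad \mu+\varepsilon\le\theta,$$ $$KL_fK_0e^{\frac{L_fK_0}{\theta-\varepsilon}}\max\Big\{\frac{1}{\theta-(\alpha-a)-\mu},\ \frac{1}{\theta+(\alpha-a)-\mu}\Big\}\le\frac1c$$ for some $c>2$. Then there exists $\tilde t_c\in(0,+\infty]$ such that for every $t\in[0,\tilde t_c)$ the map $\eta\mapsto G(t,\eta)$ is a $C^1$-diffeomorphism of $\mathbb{R}^n$.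
   Context: Standing setting: $A\colon\mathbb{R}_0^+\to M_n(\mathbb{R})$ and $f\colon\mathbb{R}_0^+\times\mathbb{R}^n\to\mathbb{R}^n$ continuous; solutions of $\dot y=A(t)y+f(t,y)$ exist on $\mathbb{R}_0^+$ and are unique; $y(s,t,\eta)$ denotes the solution through $\eta$ at time $t$. $\Phi(t,s)=\Phi(t)\Phi^{-1}(s)$ is the evolution operator of $\dot x=A(t)x$; $|\cdot|$ a norm on $\mathbb{R}^n$, $\|\cdot\|$ induced matrix norm. Nonuniform exponential dichotomy with constants $(K,\alpha,\mu)$: projector $P(\cdot)$, $K\ge1$, $\alpha>0$, $0\le\mu<\alpha$, $P(t)\Phi(t,s)=\Phi(t,s)P(s)$ for all $t,s\ge0$, $\|\Phi(t,s)P(s)\|\le Ke^{-\alpha(t-s)+\mu s}$ for $t\ge s\ge0$, $\|\Phi(t,s)(I-P(s))\|\le Ke^{\alpha(t-s)+\mu s}$ for $0\le t\le s$. Green function $\mathcal{G}(t,s)=\Phi(t,s)P(s)$ for $t\ge s\ge0$, $\mathcal{G}(t,s)=-\Phi(t,s)(I-P(s))$ for $s>t\ge0$. Nonuniform bounded growth $(K_0,a,\varepsilon)$: $K_0\ge1,a>0,\varepsilon\ge0$, $\|\Phi(t,s)\|\le K_0e^{a|t-s|+\varepsilon s}$ for all $t,s\ge0$. (P1): $|f(t,y_1)-f(t,y_2)|\le L_fe^{-\theta t}|y_1-y_2|$, $L_f>0,\theta\ge0$. (P2): $|f(t,y)|\le Me^{\delta t}$, $M>0,\delta\ge0$. (P3):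 $\partial_2 f$ (derivative in the state variable) exists and $f,\partial_2f$ are continuous in $(t,x)$. $G$ is the inverse homeomorphism of the topological conjugacy between $\dot x=A(t)x$ and $\dot y=A(t)y+f(t,y)$ given by $G(t,\eta)=\eta-\int_0^{+\infty}\mathcal{G}(t,s)f(s,y(s,t,\eta))\,ds$. *)

(* Defs.v *)
From HB Require Import structures.
From mathcomp Require Import all_boot all_order all_algebra.
From mathcomp Require Import all_classical all_reals all_analysis.
Set Implicit Arguments. Unset Strict Implicit. Unset Printing Implicit Defensive.
Import Order.TTheory GRing.Theory Num.Theory.
Import numFieldNormedType.Exports.
Local Open Scope classical_set_scope.
Local Open Scope ring_scope.

Section Defs.
Variables (R : realType) (n : nat).
Local Notation vec := 'cV[R]_n.
Local Notation mat := 'M[R]_n.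

Definition is_norm (N : vec -> R) : Prop :=
  [/\ forall x, 0 <= N x,
      forall x, N x = 0 -> x = 0,
      forall (c : R) x, N (c *: x) = `|c| * N x &
      forall x y, N (x + y) <= N x + N y].

Definition opnorm (N : vec -> R) (B : mat) : R :=
  sup [set N (B *m x) | x in [set x | N x <= 1]].

Definition is_solution (A : R -> mat) (f : R -> vec -> vec) (z : R -> vec) : Prop :=
  {within `[0%R, +oo[, continuous z} /\
  forall s : R, 0 < s -> is_derive s 1 z (A s *m z s + f s (z s)).

(* Phi(t,s) = Phi(t) Phi(s)^{-1}: for each s >= 0, t |-> Phi(t,s) is the
   matrix solution of X' = A(t) X on R_0^+ with X(s) = I. *)
Definition is_evolution_operator (A : R -> mat) (Phi : R -> R -> mat) : Prop :=
  forall s : R, 0 <= s ->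
    [/\ Phi s s = 1%:M,
        {within `[0%R, +oo[, continuous (fun t => Phi t s)} &
        forall t : R, 0 < t -> is_derive t 1 (fun t => Phi t s) (A t *m Phi t s)].

Definition green (Phi : R -> R -> mat) (P : R -> mat) (t s : R) : mat :=
  if s <= t then Phi t s *m P s else - (Phi t s *m (1%:M - P s)).

Definition integral0oo (F : R -> vec) : vec :=
  \col_i (Rintegral (@lebesgue_measure R) `[0%R, +oo[ (fun s => F s i ord0)).

Definition Gmap (Phi : R -> R -> mat) (P : R -> mat) (f : R -> vec -> vec)
  (ysol : R -> R -> vec -> vec) (t : R) (eta : vec) : vec :=
  eta - integral0oo (fun s => green Phi P t s *m f s (ysol s t eta)).

(* C^1 map of R^n: differentiable everywhere with continuous derivative
   (continuity of x |-> Dg(x) v for every direction v, i.e. of the Jacobian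
   entries, equivalent in finite dimension). *)
Definition C1 (g : vec -> vec) : Prop :=
  (forall x, differentiable g x) /\ (forall v : vec, continuous (fun x => 'd g x v)).

Definition C1_diffeo (g : vec -> vec) : Prop :=
  exists h : vec -> vec, [/\ cancel g h, cancel h g, C1 g & C1 h].

Definition d2 (f : R -> vec -> vec) (t : R) (x v : vec) : vec := 'd (f t) x v.

End Defs.

(* Main.v *)
Require Import Defs.
From HB Require Import structures.
From mathcomp Require Import all_boot all_order all_algebra.
From mathcomp Require Import all_classical all_reals all_analysis.
From mathcomp Require Import measurable_realfun.
From mathcomp Require Import ring lra.
Import Order.TTheory GRing.Theory Num.Theory.
Import numFieldNormedType.Exports.
Local Open Scope classical_set_scope.
Local Open Scope ring_scope.

(** [G t] is the identity minus [g eta = \int_0^oo green(t,s) f(s, y(s,t,eta)) ds],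
    so it suffices that [g] is C^1 and a contraction for the given norm.

    Contraction: Gronwall's inequality with the bounded growth estimate gives
    [|y(s,t,eta1) - y(s,t,eta2)| <= K0 e^(Lf K0/(theta-eps)) e^(a(s-t)+eps t)
    |eta1 - eta2|] for [s >= t], whence the part of the integral after [t] has
    Lipschitz constant at most [1/c < 1/2]; the part before [t] has Lipschitz
    constant [O(t)], which fixes [tc].

    Smoothness: a map is C^1 as soon as its directional difference quotients are
    Cauchy, uniformly near each base point. For the flow this follows from
    Gronwall applied to the difference of two such quotients; the estimate is
    uniform for [s] in compact sets, and exponential decay of the integrand
    transfers it to [g]. The inverse of [id - g] inherits the same property. *)

(** Two kinds of estimate coexist. The Lipschitz constant of [g] must meet the prescribed bound
    [1 / c], so it is computed in the given norm [N], where passing to an equivalent norm would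
    spoil it. As [N] need not be differentiable, the sharp inequalities for [N] of a solution or of
    an integral all come from a mean value inequality proved by minimisation. Smoothness and
    compactness tolerate any constant, so they are treated in the matrix norm, and equivalence of
    norms links the two. Accordingly there are two Gronwall bounds: a crude one on compact time
    intervals, valid forward and backward, and a sharp one for [s >= t] only. The crude one suffices
    before [t], because its constant is multiplied by the length [t]. After [t] the sharp one
    produces the constant of the hypothesis times [expR ((mu + eps - theta) * t)], and
    [mu + eps <= theta] makes this uniform in [t]. *)

Section Norms.
Set Implicit Arguments. Unset Strict Implicit. Unset Printing Implicit Defensive.

Lemma continuous_epsdelta (R : realType) (V W : normedModType R) (f : V -> W)
    (x : V) :
  {for x, continuous f} <-> (forall e : R, 0 < e -> exists2 d, 0 < d &
    forall y, `|y - x| < d -> `|f y - f x| < e).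
Proof.
rewrite /prop_for /continuous_at; split.
  move=> /cvgrPdistC_lt fx e /fx /nbhs_normP[d /= d0 H]; exists d => // y yx.
  by apply: H; rewrite /= distrC.
move=> H; apply/cvgrPdistC_lt => e /H[d d0 Hd]; apply/nbhs_normP; exists d => //.
by move=> y /=; rewrite distrC; exact: Hd.
Qed.

Context {R : realType} {n : nat}.
Local Notation vec := 'cV[R]_n.
Implicit Types (N : vec -> R) (x y : vec).

Lemma mx_entry_le_norm m p (B : 'M[R]_(m, p)) i j : `|B i j| <= `|B|.
Proof.
rewrite [leRHS]/Num.Def.normr/= mx_normrE.
exact: (le_bigmax _ (fun ij : 'I_m * 'I_p => `|B ij.1 ij.2|) (i, j)).
Qed.

Lemma mx_norm_le m p (B : 'M[R]_(m, p)) (c : R) :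
  0 <= c -> (forall i j, `|B i j| <= c) -> `|B| <= c.
Proof.
move=> c0 Bc; rewrite [leLHS]/Num.Def.normr/= mx_normrE.
by apply: bigmax_le => // -[i j] _; exact: Bc.
Qed.

Lemma cV_sum_delta x : x = \sum_j x j ord0 *: delta_mx j ord0.
Proof.
apply/colP => i; rewrite summxE (bigD1 i)//= big1 ?addr0.
  by rewrite !mxE !eqxx mulr1.
by move=> j ji; rewrite !mxE eq_sym (negbTE ji) mulr0.
Qed.

Lemma mulmx_norm_le m p q (B : 'M[R]_(m, p)) (D : 'M[R]_(p, q)) :
  `|B *m D| <= p%:R * `|B| * `|D|.
Proof.
apply: mx_norm_le => [|i j]; first by rewrite !mulr_ge0.
rewrite mxE (le_trans (ler_norm_sum _ _ _))//.
have -> : p%:R * `|B| * `|D| = \sum_(k < p) (`|B| * `|D|).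
  by rewrite sumr_const card_ord -[RHS]mulr_natl mulrA.
apply: ler_sum => k _.
by rewrite normrM ler_pM// mx_entry_le_norm.
Qed.

Lemma is_norm_mx_norm : is_norm (fun x : vec => `|x|).
Proof.
by split=> [x|x /normr0_eq0//|c x|x y]; rewrite ?normrZ ?ler_normD.
Qed.

Lemma is_normN N x : is_norm N -> N (- x) = N x.
Proof. by move=> [_ _ NZ _]; rewrite -scaleN1r NZ normrN1 mul1r. Qed.

Lemma is_norm0 N : is_norm N -> N 0 = 0.
Proof. by move=> [_ _ NZ _]; rewrite -(scale0r 0) NZ normr0 mul0r. Qed.

Lemma is_norm_distD N x y : is_norm N -> N (x - y) <= N x + N y.
Proof. by move=> hN; rewrite -(is_normN y hN); case: hN. Qed.

Lemma is_norm_sum N (I : Type) (r : seq I) (F : I -> vec) :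
  is_norm N -> N (\sum_(i <- r) F i) <= \sum_(i <- r) N (F i).
Proof.
move=> hN; have [_ _ _ ND] := hN.
elim/big_ind2 : _ => [|u v w z uv wz|//]; first by rewrite is_norm0.
exact: le_trans (ND _ _) (lerD uv wz).
Qed.

Lemma is_norm_upper N : is_norm N ->
  exists2 C, 0 < C & forall x, N x <= C * `|x|.
Proof.
move=> hN; have [N0 _ NZ _] := hN.
exists (1 + \sum_j N (delta_mx j ord0)).
  by rewrite ltr_pwDl// sumr_ge0.
move=> x; rewrite [in leLHS](cV_sum_delta x).
apply: le_trans (is_norm_sum _ _ hN) _.
rewrite mulrDl mul1r mulr_suml ler_wpDl// ler_sum// => j _.
by rewrite NZ mulrC ler_wpM2l// mx_entry_le_norm.
Qed.

Lemma is_norm_lipschitz N (C : R) : is_norm N ->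
  (forall x, N x <= C * `|x|) -> forall x y, `|N x - N y| <= C * `|x - y|.
Proof.
move=> hN NC x y; have [_ _ _ ND] := hN.
rewrite ler_norml; apply/andP; split.
  rewrite lerNl opprB lerBlDr; apply: le_trans (_ : N (y - x) + N x <= _).
    by rewrite -{1}(subrK x y).
  by rewrite lerD2r distrC.
rewrite lerBlDr; apply: le_trans (_ : N (x - y) + N y <= _).
  by rewrite -{1}(subrK y x).
by rewrite lerD2r.
Qed.

Lemma is_norm_continuous N : is_norm N -> continuous N.
Proof.
move=> hN x; have [C C0 NC] := is_norm_upper hN.
apply/continuous_epsdelta => e e0.
exists (e / C) => [|y xy]; first exact: divr_gt0.
by rewrite (le_lt_trans (is_norm_lipschitz hN NC y x))// mulrC -ltr_pdivlMr.
Qed.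

Lemma mx_norm_trmx m p (B : 'M[R]_(m, p)) : `|B^T| = `|B|.
Proof.
apply/eqP; rewrite eq_le; apply/andP; split; apply: mx_norm_le => // i j.
  by rewrite mxE mx_entry_le_norm.
by have := mx_entry_le_norm B^T j i; rewrite mxE.
Qed.

Lemma continuous_trmx m p : continuous (@trmx R m p).
Proof.
move=> B; apply/continuous_epsdelta => e e0.
by exists e => // D; rewrite -raddfB/= mx_norm_trmx.
Qed.

(* By compactness, [N] attains a positive minimum on the unit sphere. *)
Lemma is_norm_lower N : is_norm N ->
  exists2 C, 0 < C & forall x, `|x| <= C * N x.
Proof.
move=> hN; have [N0 NI NZ _] := hN.
(* The sphere is taken among row vectors, to which [bounded_closed_compact] applies; transposition
   is an isometry. *)
pose S := [set u : 'rV[R]_n | `|u| = 1].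
have cS : compact S.
  apply: bounded_closed_compact.
    exists 1; split => // M M1 u /= ->; exact: ltW.
  rewrite (_ : S = (fun u : 'rV[R]_n => `|u|) @^-1` [set 1])//.
  apply: closed_comp; last exact: closed_eq.
  by move=> u _; exact: norm_continuous.
have cf : {within S, continuous (fun u : 'rV[R]_n => N u^T)}.
  apply: continuous_subspaceT => u.
  apply: continuous_comp; first exact: continuous_trmx.
  exact: is_norm_continuous.
(* The sphere is empty when [n = 0]; then every vector is 0 and any constant works. *)
have [/set0P S0|] := boolP (S != set0); last first.
  move=> /negbNE/eqP S0; exists 1 => // x; rewrite mul1r.
  have [->|x0] := eqVneq x 0; first by rewrite normr0 is_norm0.
  exfalso; have : S (`|x|^-1 *: x)^T.
    by rewrite /S/= mx_norm_trmx normrZ normfV normr_id mulVf// normr_eq0.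
  by rewrite S0.
have [u uS umin] := compact_EVT_min S0 cS cf.
have u1 : `|u| = 1 by rewrite inE in uS.
have Nu : 0 < N u^T.
  rewrite lt_neqAle N0 andbT; apply/eqP => /esym/NI u0.
  by have := u1; rewrite -mx_norm_trmx u0 normr0; lra.
exists (N u^T)^-1; first by rewrite invr_gt0.
move=> x; have [->|x0] := eqVneq x 0; first by rewrite normr0 is_norm0// mulr0.
have nx0 : 0 < `|x| by rewrite normr_gt0.
have /umin : ((`|x|^-1 *: x)^T : 'rV[R]_n) \in S.
  by rewrite inE /S/= mx_norm_trmx normrZ normfV normr_id mulVf// normr_eq0.
rewrite trmxK NZ normfV normr_id => h.
by rewrite mulrC ler_pdivlMr// -ler_pdivlMl.
Qed.

(** [sup] bounds its set only if the set is nonempty and bounded above; boundedness comes from the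
    equivalence of [N] with the matrix norm. Homogeneity reduces to [N x = 1]. *)
Lemma opnorm_bound N (B : 'M[R]_n) x : is_norm N ->
  N (B *m x) <= opnorm N B * N x.
Proof.
move=> hN; have [N0 NI NZ _] := hN.
have [C C0 NC] := is_norm_upper hN; have [D D0 ND] := is_norm_lower hN.
have [->|x0] := eqVneq x 0; first by rewrite mulmx0 is_norm0// mulr0.
have Nx : 0 < N x.
  by rewrite lt_neqAle N0 andbT; apply/eqP => /esym/NI/eqP; rewrite (negbTE x0).
rewrite -ler_pdivrMr//.
have -> : N (B *m x) / N x = N (B *m ((N x)^-1 *: x)).
  by rewrite -scalemxAr NZ normfV ger0_norm// mulrC.
apply: sup_upper_bound; last first.
  by exists ((N x)^-1 *: x) => //=; rewrite NZ normfV ger0_norm// mulVf// gt_eqF.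
split; first by exists (N (B *m 0)), 0 => //=; rewrite is_norm0.
exists (C * (n%:R * `|B| * (D * 1))) => _ [y /= y1 <-].
rewrite (le_trans (NC _))// ler_pM2l// (le_trans (mulmx_norm_le _ _))//.
rewrite ler_wpM2l// ?mulr_ge0// (le_trans (ND _))// ler_pM2l//.
Qed.

End Norms.

(** * Strict derivatives, Cauchy difference quotients, and the identity minus a contraction *)

Section StrictDifferentiability.
Set Implicit Arguments. Unset Strict Implicit. Unset Printing Implicit Defensive.
Context {R : realType} {n : nat}.
Local Notation vec := 'cV[R]_n.
Implicit Types (N : vec -> R) (x y : vec) (g : vec -> vec).

Lemma cauchy_seq_cV (u : nat -> vec) :
  (forall e : R, 0 < e -> exists m, forall i j, (m <= i)%N -> (m <= j)%N ->
    `|u i - u j| < e) ->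
  exists l, forall e : R, 0 < e -> exists m, forall i, (m <= i)%N ->
    `|u i - l| < e.
Proof.
move=> cu; have : cvg (u @ \oo).
  apply/cauchy_cvgP/cauchy_exP => e /cu[m um]; exists (u m).
  exists m => // i /= mi; rewrite -ball_normE/=; exact: um.
move=> /cvg_ex[l /cvgrPdistC_lt ul]; exists l => e /ul[m _ um].
by exists m => i mi; apply: um.
Qed.

(** Both points move, so differentiability near [x] already forces continuity of the derivative at
    [x]. *)
Definition strict_deriv g x (M : 'M[R]_n) :=
  forall e : R, 0 < e -> exists2 d, 0 < d & forall x1 x2,
    `|x1 - x| < d -> `|x2 - x| < d ->
    `|g x1 - g x2 - M *m (x1 - x2)| <= e * `|x1 - x2|.

Definition dquot g v x (h : R) : vec := h^-1 *: (g (x + h *: v) - g x).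

(** No candidate derivative appears, so the condition can be carried through Gronwall estimates and
    integrals before any derivative is known. *)
Definition cauchy_dquot g := forall x v (e : R), 0 < e ->
  exists2 d, 0 < d & forall x1 x2 h k, `|x1 - x| < d -> `|x2 - x| < d ->
    h != 0 -> k != 0 -> `|h| < d -> `|k| < d ->
    `|dquot g v x1 h - dquot g v x2 k| <= e.

Lemma cauchy_dquot_lim g : cauchy_dquot g -> forall x v, exists l,
  forall e : R, 0 < e -> exists2 d, 0 < d & forall x1 h, `|x1 - x| < d ->
    h != 0 -> `|h| < d -> `|dquot g v x1 h - l| <= e.
Proof.
move=> cg x v; pose h (m : nat) : R := m.+1%:R^-1.
have h0 m : h m != 0 by rewrite invr_eq0 pnatr_eq0.
have hsmall (d : R) : 0 < d -> exists m, forall i, (m <= i)%N -> `|h i| < d.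
  move=> d0; exists (Num.truncn d^-1) => i mi.
  rewrite ger0_norm ?invr_ge0// /h invf_plt ?posrE//.
  by rewrite (lt_le_trans (truncnS_gt _))// ler_nat.
have [e e0|l ul] := @cauchy_seq_cV (fun m => dquot g v x (h m)).
  have [d d0 gd] := cg x v _ (divr_gt0 e0 (ltr0n _ 2)).
  have [m hm] := hsmall _ d0; exists m => i j mi mj.
  apply: le_lt_trans (_ : e / 2 < e); last by rewrite ltr_pdivrMr//; lra.
  by apply: gd; rewrite ?subrr ?normr0// hm.
exists l => e e0; have e20 : 0 < e / 2 by rewrite divr_gt0.
have [d d0 gd] := cg x v _ e20; exists d => // x1 k x1x k0 kd.
have [m hm] := hsmall _ d0; have [m' hm'] := ul _ e20.
pose i := maxn m m'.
rewrite (le_trans (ler_distD (dquot g v x (h i)) _ _))// (splitr e) lerD//.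
  by apply: gd; rewrite ?subrr ?normr0// hm// leq_maxl.
by apply/ltW/hm'; exact: leq_maxr.
Qed.

(** Walk from [x2] to [x1] one coordinate at a time: each step is a difference quotient along a
    basis vector, based near [x], hence close to its limit [L k]; the columns [L k] form the
    derivative. *)
Lemma cauchy_dquot_strict_deriv g : cauchy_dquot g ->
  forall x, exists M, strict_deriv g x M.
Proof.
move=> cg x.
have /choice[L HL] j := cauchy_dquot_lim cg x (delta_mx j ord0 : vec).
exists (\matrix_(i, j) L j i ord0) => e e0.
(* There are [n] steps with error [e' * |w|] each; [n.+1] also covers [n = 0]. *)
pose e' := e / n.+1%:R; have e'0 : 0 < e' by rewrite divr_gt0.
have /choice[D HD] j : exists d : R, 0 < d /\ forall x1 h, `|x1 - x| < d ->
    h != 0 -> `|h| < d -> `|dquot g (delta_mx j ord0) x1 h - L j| <= e'.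
  by have [d d0 H] := HL j _ e'0; exists d.
pose d := \big[Num.min/1]_j D j.
have d0 : 0 < d.
  by rewrite /d; elim/big_ind : _ => // [u v u0 v0|j _];
    [rewrite lt_min u0|case: (HD j)].
have dD j : d <= D j by exact: bigmin_le.
(* Then [|w| < 2 d / 3], and every corner [p k] of the path stays within [d] of [x]. *)
exists (d / 3%:R); first by rewrite divr_gt0.
move=> x1 x2 hx1 hx2; set w := x1 - x2.
have wd : `|w| < d * (2 / 3).
  rewrite /w -(subrKA x) (le_lt_trans (ler_normD _ _))//.
  rewrite (distrC x x2).
  move: hx1 hx2; set a := `|_|; set b := `|_|; lra.
pose p k : vec := x2 + \col_i (if (i < k)%N then w i ord0 else 0).
have p0 : p 0%N = x2.
  by rewrite /p (_ : (\col_i _) = 0) ?addr0//; apply/colP => i; rewrite !mxE.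
have pn : p n = x1.
  rewrite /p (_ : (\col_i _) = w) ?subrKC//.
  by apply/colP => i; rewrite !mxE ltn_ord.
have pS (k : 'I_n) : p k.+1 = p k + w k ord0 *: delta_mx k ord0.
  rewrite /p -addrA; congr (_ + _); apply/colP => i; rewrite !mxE ltnS leq_eqVlt.
  have [->|ik] := eqVneq i k; first by rewrite !eqxx ltnn mulr1 add0r.
  by rewrite (_ : (i == k :> nat) = false) ?mulr0 ?addr0//; exact/negbTE.
have px k : `|p k - x| < d.
  have : `|p k - x2| <= `|w|.
    rewrite /p addrC addKr; apply: mx_norm_le => // i j; rewrite mxE.
    by case: ifPn => _; rewrite ?normr0// mx_entry_le_norm.
  have := ler_distD x2 (p k) x.
  move: hx2 wd d0; set a := `|_|; set b := `|_|; set c := `|_|; set f := `|_|.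
  lra.
have -> : g x1 - g x2 = \sum_(k < n) (g (p k.+1) - g (p k)).
  by rewrite -(big_mkord xpredT (fun k => g (p k.+1) - g (p k)))
       telescope_sumr// p0 pn.
have -> : (\matrix_(i, j) L j i ord0) *m w = \sum_(k < n) w k ord0 *: L k.
  apply/colP => i; rewrite summxE mxE; apply: eq_bigr => j _.
  by rewrite !mxE mulrC.
rewrite -sumrB (le_trans (ler_norm_sum _ _ _))//.
apply: (@le_trans _ _ (\sum_(k < n) e' * `|w|)).
  apply: ler_sum => k _; rewrite pS.
  have [->|wk0] := eqVneq (w k ord0) 0.
    by rewrite !scale0r addr0 subrr subr0 normr0 mulr_ge0// ltW.
  have := (HD k).2 (p k) (w k ord0) (lt_le_trans (px k) (dD k)) wk0.
  have wkw : `|w k ord0| <= `|w| := mx_entry_le_norm w k ord0.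
  have wkD : `|w k ord0| < D k.
    rewrite (le_lt_trans wkw)// (lt_le_trans wd)// (le_trans _ (dD k))//.
    by move: d0; set a := d; lra.
  move=> /(_ wkD); rewrite /dquot => H.
  rewrite -[X in X - _](scalerKV wk0) -scalerBr normrZ mulrC.
  by rewrite ler_pM.
rewrite sumr_const card_ord -[leLHS]mulr_natl mulrA ler_wpM2r// /e'.
rewrite mulrCA ler_piMr ?(ltW e0)// ler_pdivrMr// mul1r ler_nat//.
Qed.

Lemma mulmx_continuous (M : 'M[R]_n) : continuous (fun v : vec => M *m v).
Proof.
move=> v; apply/continuous_epsdelta => e e0.
have c0 : 0 < n%:R * `|M| + 1 by rewrite ltr_wpDl// mulr_ge0.
exists (e / (n%:R * `|M| + 1)) => [|y]; first exact: divr_gt0.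
rewrite ltr_pdivlMr// -mulmxBr => yv; rewrite (le_lt_trans (mulmx_norm_le _ _))//.
by rewrite (le_lt_trans _ yv)// mulrC ler_wpM2l// lerDl.
Qed.

Lemma strict_deriv_diff g x M : strict_deriv g x M ->
  differentiable g x /\ 'd g x = mulmx M :> (vec -> vec).
Proof.
move=> gM; have cM := @mulmx_continuous M.
have H : g \o shift x = cst (g x) + mulmx M +o_ (0 : vec) id.
  apply/eqaddoP => e e0; have [d d0 gd] := gM e e0.
  apply: filterS (nbhs0_lt d0) => v vd.
  rewrite -[(_ - _) v]/(g (v + x) - (g x + M *m v)).
  have := gd (v + x) x; rewrite addrK subrr normr0 => /(_ vd d0).
  by rewrite opprD addrA.
have dE : 'd g x = mulmx M :> (vec -> vec) by exact: diff_unique.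
by split => //; apply/diff_locallyP; rewrite dE.
Qed.

(** For [y] near [x], the same small increment [g (h *: v + y) - g y] is approximated by both [M x]
    and [M y], so [M x *m v] and [M y *m v] nearly agree. *)
Lemma strict_deriv_C1 g : (forall x, exists M, strict_deriv g x M) -> C1 g.
Proof.
move=> /choice[M HM].
have dM x := (strict_deriv_diff (HM x)).2.
split=> [x|v]; first exact: (strict_deriv_diff (HM x)).1.
have -> : (fun x => 'd g x v) = (fun x => M x *m v).
  by apply/funext => y; rewrite dM.
move=> x; apply/continuous_epsdelta => e e0.
have v10 : 0 < `|v| + 1 by rewrite ltr_wpDl.
pose e' := e / (3%:R * (`|v| + 1)).
have e'0 : 0 < e' by rewrite divr_gt0// mulr_gt0.
have [d d0 gd] := HM x _ e'0; exists (d / 2); first by rewrite divr_gt0.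
move=> y yx.
have [d' d'0 gd'] := HM y _ e'0.
have m0 : 0 < Num.min d' (d / 2) by rewrite lt_min d'0 divr_gt0.
pose h := Num.min d' (d / 2) / 2 / (`|v| + 1).
have h0 : 0 < h by rewrite !divr_gt0.
have hv : `|h *: v| < Num.min d' (d / 2).
  rewrite normrZ gtr0_norm// /h mulrAC ltr_pdivrMr//.
  by move: m0 (normr_ge0 v); set m := Num.min _ _; set a := `|v|; nra.
have := hv; rewrite lt_min => /andP[hvd' hvd].
have := gd' (h *: v + y) y; rewrite addrK subrr normr0 => /(_ hvd' d'0).
have := gd (h *: v + y) y; rewrite addrK => H1 H2.
have {}H1 : `|g (h *: v + y) - g y - M x *m (h *: v)| <= e' * `|h *: v|.
  apply: H1; rewrite ?(lt_trans yx)//; last by move: d0; set a := d; lra.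
  rewrite -addrA (le_lt_trans (ler_normD _ _))//.
  by move: hvd yx; set a := `|_|; set b := `|_|; lra.
have : `|h *: (M y *m v - M x *m v)| <= 2 * e' * `|h *: v|.
  have -> : h *: (M y *m v - M x *m v) =
     (g (h *: v + y) - g y - M x *m (h *: v)) -
     (g (h *: v + y) - g y - M y *m (h *: v)).
    rewrite -!scalemxAr; move: (M y *m v) (M x *m v) (g _) (g _) => a b u w.
    by apply/colP => i; rewrite !mxE; ring.
  rewrite (le_trans (ler_normB _ _))//.
  by move: H1 H2; set a := `|_|; set b := `|_|; lra.
rewrite !(normrZ h) (gtr0_norm h0) mulrCA ler_pM2l// => /le_lt_trans; apply.
have eE : e = e' * (3 * (`|v| + 1)) by rewrite divfK// gt_eqF// mulr_gt0.
rewrite [ltRHS]eE; have := mulr_ge0 (ltW e'0) (normr_ge0 v).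
by move: e'0; move: (e') `|v| => u w; lra.
Qed.

Lemma cauchy_dquot_C1 g : cauchy_dquot g -> C1 g.
Proof. by move=> /cauchy_dquot_strict_deriv/strict_deriv_C1. Qed.


(** Banach iteration, started at 0, for the fixed point equation of [T x = y + g x]. *)
Lemma contraction_sub_surj N (q : R) g : is_norm N -> 0 <= q -> q < 1 ->
  (forall x y, N (g x - g y) <= q * N (x - y)) ->
  forall y, exists x, x - g x = y.
Proof.
move=> hN q0 q1 gq y; have [N0 NI NZ ND] := hN.
have [C C0 NC] := is_norm_upper hN; have [D D0 DN] := is_norm_lower hN.
pose T x := y + g x; pose u m := iter m T 0.
have Tq x z : N (T x - T z) <= q * N (x - z).
  by rewrite /T opprD addrACA subrr add0r.
have q10 : 0 < 1 - q by rewrite subr_gt0.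
pose b := N (u 1%N) / (1 - q).
have b0 : 0 <= b by rewrite divr_ge0// ltW.
have ub m : N (u m) <= b.
  elim: m => [|m IH]; first by rewrite is_norm0.
  have := ND (u m.+1 - u 1%N) (u 1%N); rewrite subrK => /le_trans; apply.
  have := Tq (u m) 0; rewrite subr0 => /le_trans/(_ (ler_wpM2l q0 IH)) h.
  apply: le_trans (lerD h (lexx _)) _.
  have -> : N (u 1%N) = b * (1 - q) by rewrite /b divfK// gt_eqF.
  by rewrite -mulrC -mulrDr addrC subrK mulr1.
(* [u (k + m)] and [u k] are the images of [u m] and 0 under [k] iterations of [T]; the orbit bound
   [b] then gives a geometric rate. *)
have uq k m : N (u (k + m)%N - u k) <= q ^+ k * b.
  elim: k => [|k IH]; first by rewrite subr0 expr0 mul1r.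
  rewrite addSn exprS -mulrA (le_trans (Tq _ _))// ler_wpM2l//.
have qcvg (e : R) : 0 < e -> exists k, D * (q ^+ k * b) < e.
  move=> e0; have : (fun k => D * b * q ^+ k) @ \oo --> (0 : R).
    rewrite -(mulr0 (D * b)); apply: cvgMr.
    by apply: cvg_expr; rewrite ger0_norm.
  move=> /cvgrPdistC_lt/(_ _ e0)[k _ /(_ _ (leqnn k))].
  rewrite subr0 => /(le_lt_trans (ler_norm _)) h; exists k.
  by rewrite (mulrC _ b) mulrA.
have [e e0|l ul] := @cauchy_seq_cV u.
  have [k hk] := qcvg _ (divr_gt0 e0 (ltr0n _ 2)); exists k => i j ki kj.
  rewrite (le_lt_trans (ler_distD (u k) _ _))//.
  have H i' : (k <= i')%N -> `|u i' - u k| < e / 2.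
    move=> ki'; rewrite (le_lt_trans (DN _))// (le_lt_trans _ hk)//.
    by rewrite ler_pM2l// -(subnKC ki') uq.
  by rewrite (distrC (u k)) (splitr e) ltrD ?H.
exists l.
suff: N (l - T l) = 0 by move=> /NI/subr0_eq {1}->; rewrite /T addrK.
apply/eqP; rewrite eq_le N0 andbT; apply/ler_addgt0Pr => e e0; rewrite add0r.
have e'0 : 0 < e / (C * 2) by rewrite divr_gt0// mulr_gt0.
have [m um] := ul _ e'0.
have h1 : N (l - u m.+1) <= e / 2.
  rewrite (le_trans (NC _))// distrC -ler_pdivlMl// (le_trans (ltW (um _ _)))//.
  by rewrite invfM mulrCA.
have h2 : N (u m.+1 - T l) <= e / 2.
  rewrite (le_trans (Tq _ _))// (@le_trans _ _ (N (u m - l)))//.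
    by rewrite ler_piMl// ltW.
  rewrite (le_trans (NC _))// -ler_pdivlMl// (le_trans (ltW (um _ _)))//.
  by rewrite invfM mulrCA.
have := ND (l - u m.+1) (u m.+1 - T l); rewrite subrKA => /le_trans; apply.
by rewrite (splitr e) lerD.
Qed.

(** On increments [h *: u] with [h] small, the remainder is negligible relative to [h], so the
    contraction bound passes to [M]. This is what bounds [1 - M] below by [1 - q] in [N]. *)
Lemma strict_deriv_contraction N (q : R) g x M : is_norm N -> strict_deriv g x M ->
  (forall x y, N (g x - g y) <= q * N (x - y)) -> forall u, N (M *m u) <= q * N u.
Proof.
move=> hN gM gq u; have [N0 NI NZ ND] := hN.
have [C C0 NC] := is_norm_upper hN.
apply/ler_addgt0Pr => e e0.
have u10 : 0 < `|u| + 1 by rewrite ltr_wpDl.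
have e'0 : 0 < e / (C * (`|u| + 1)) by rewrite divr_gt0// mulr_gt0.
have [d d0 gd] := gM _ e'0.
pose h := d / 2 / (`|u| + 1); have h0 : 0 < h by rewrite !divr_gt0.
have hu : `|h *: u| < d.
  rewrite normrZ gtr0_norm// /h mulrAC ltr_pdivrMr//.
  by move: d0 (normr_ge0 u); set a := `|u|; move: (d) => m; nra.
have := gd (h *: u + x) x; rewrite addrK subrr normr0 => /(_ hu d0) H.
rewrite -(ler_pM2l h0) mulrDr.
have -> : h * N (M *m u) = N (M *m (h *: u)) by rewrite -scalemxAr NZ gtr0_norm.
rewrite -[M *m (h *: u)](subKr (g (h *: u + x) - g x)).
rewrite (le_trans (is_norm_distD _ _ hN))// lerD//.
  by rewrite (le_trans (gq _ _))// addrK NZ gtr0_norm// mulrCA.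
rewrite (le_trans (NC _))// -ler_pdivlMl// (le_trans H)//.
rewrite normrZ gtr0_norm// mulrCA [leRHS]mulrCA ler_pM2l//.
rewrite invfM mulrA (mulrC C^-1) -[leLHS]mulrA ler_piMr//.
  by rewrite divr_ge0// ltW.
by rewrite mulrC ler_pdivrMr// mul1r lerDl.
Qed.

(* The increments of the inverse satisfy a linear equation up to a strictly
   small remainder, and [1 - M] is bounded below, so its difference quotients
   are again Cauchy; no inverse matrix is needed. *)
Lemma id_sub_contraction_C1_diffeo N (q : R) g : is_norm N -> 0 <= q -> q < 1 ->
  (forall x y, N (g x - g y) <= q * N (x - y)) -> cauchy_dquot g ->
  C1_diffeo (fun x => x - g x).
Proof.
move=> hN q0 q1 gq cg; have [N0 NI NZ ND] := hN.
have [C C0 NC] := is_norm_upper hN; have [D D0 DN] := is_norm_lower hN.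
have q10 : 0 < 1 - q by rewrite subr_gt0.
have Mex := cauchy_dquot_strict_deriv cg.
pose F x := x - g x.
(* This expansion estimate gives injectivity of [F] and, through equivalence of norms, the Lipschitz
   constant [L] of its inverse. *)
have Fexp x y : (1 - q) * N (x - y) <= N (F x - F y).
  have -> : F x - F y = (x - y) - (g x - g y) by rewrite /F opprD addrACA -opprD.
  have := ND (x - y - (g x - g y)) (g x - g y); rewrite subrK.
  by have := gq x y; set a := N _; set b := N _; set c := N _; lra.
have /choice[h hK] := contraction_sub_surj hN q0 q1 gq.
have Fh : cancel h F by move=> y; exact: hK.
have hF : cancel F h.
  move=> x; apply/subr0_eq/NI/eqP; rewrite eq_le N0 andbT.
  by have := Fexp (h (F x)) x; rewrite Fh subrr is_norm0// pmulr_rle0.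
exists h; split => //.
  apply: strict_deriv_C1 => x; have [M HM] := Mex x; exists (1%:M - M).
  move=> e /HM[d d0 Hd]; exists d => // x1 x2 x1d x2d.
  rewrite mulmxBl mul1mx /F.
  have -> : x1 - g x1 - (x2 - g x2) - (x1 - x2 - M *m (x1 - x2)) =
     - (g x1 - g x2 - M *m (x1 - x2)).
    by move: (M *m _) => z; apply/colP => i; rewrite !mxE; ring.
  by rewrite normrN Hd.
have [L [L0 LE]] : exists L : R, 0 < L /\ L = D * (C / (1 - q)).
  by exists (D * (C / (1 - q))); rewrite mulr_gt0// divr_gt0.
have DL y1 y2 : (1 - q) * N (y1 - y2) <= C * `|F y1 - F y2|.
  by rewrite (le_trans (Fexp _ _)).
have hL y1 y2 : `|h y1 - h y2| <= L * `|y1 - y2|.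
  rewrite (le_trans (DN _))// LE -mulrA ler_pM2l// mulrAC ler_pdivlMr// mulrC.
  by rewrite (le_trans (DL _ _))// !Fh.
apply: cauchy_dquot_C1 => y v e e0.
have [M HM] := Mex (h y); have Mq := strict_deriv_contraction hN HM gq.
(* Two remainders of size [e / (B + 1) * (L * |v|)] are amplified by [D * C / (1 - q)], which is
   [L]; with this [B] the total is [e * (B / (B + 1))]. *)
have [B [B0 BE]] : exists B : R, 0 <= B /\ B = L * (2 * (L * `|v|)).
  by exists (L * (2 * (L * `|v|))); rewrite !mulr_ge0// ltW.
have e'0 : 0 < e / (B + 1) by rewrite divr_gt0// ltr_wpDl.
have [d d0 Hd] := HM _ e'0.
have v10 : 0 < `|v| + 1 by rewrite ltr_wpDl.
have d'0 : 0 < d / (L * (`|v| + 1)) by rewrite divr_gt0// mulr_gt0.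
(* As [h] is [L]-Lipschitz, this radius keeps both [h y1] and [h (y1 + k *: v)] within [d] of
   [h y]. *)
exists (d / (L * (`|v| + 1))) => //.
have key y1 k : `|y1 - y| < d / (L * (`|v| + 1)) -> k != 0 ->
    `|k| < d / (L * (`|v| + 1)) -> exists r, [/\ `|r| <= e / (B + 1) * (L * `|v|) &
       dquot h v y1 k - M *m dquot h v y1 k = v + r].
  move=> y1y k0 kd; pose x1 := h y1; pose x2 := h (y1 + k *: v).
  exists (k^-1 *: (g x2 - g x1 - M *m (x2 - x1))).
  have x1d : `|x1 - h y| < d.
    rewrite (le_lt_trans (hL _ _))// -ltr_pdivlMl// mulrC (lt_le_trans y1y)//.
    rewrite invfM mulrA; apply: ler_piMr; first by rewrite divr_ge0// ltW.
    by rewrite invf_le1// lerDr.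
  have x2d : `|x2 - h y| < d.
    rewrite (le_lt_trans (hL _ _))// -ltr_pdivlMl//.
    rewrite addrAC (le_lt_trans (ler_normD _ _))// normrZ.
    have -> : L^-1 * d = d / (L * (`|v| + 1)) + d / (L * (`|v| + 1)) * `|v|.
      by field; rewrite !gt_eqF.
    by rewrite ltr_leD// ler_wpM2r// ltW.
  split.
    rewrite normrZ normfV -ler_pdivlMl ?invr_gt0 ?normr_gt0// invrK.
    rewrite (le_trans (Hd _ _ x2d x1d))// mulrCA ler_pM2l// mulrCA.
    rewrite (le_trans (hL _ _))// addrC addKr normrZ//.
  rewrite /dquot -/x1 -/x2 -scalemxAr -scalerBr.
  have E : x2 - x1 = k *: v + (g x2 - g x1).
    have : F x2 - F x1 = k *: v by rewrite !Fh addrC addKr.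
    by move=> <-; rewrite /F; move: (g _) (g _) => a b; apply/colP => i;
      rewrite !mxE; ring.
  by rewrite {1}E -addrA scalerDr scalerA mulVf// scale1r.
move=> y1 y2 k1 k2 y1d y2d k10 k20 k1d k2d.
have [r1 [r1e E1]] := key _ _ y1d k10 k1d.
have [r2 [r2e E2]] := key _ _ y2d k20 k2d.
set u1 := dquot h v y1 k1 in E1 *; set u2 := dquot h v y2 k2 in E2 *.
have E : (u1 - u2) - M *m (u1 - u2) = r1 - r2.
  have -> : u1 - u2 - M *m (u1 - u2) = (u1 - M *m u1) - (u2 - M *m u2).
    rewrite mulmxBr; move: (M *m u1) (M *m u2) => a c.
    by apply/colP => i; rewrite !mxE; ring.
  by rewrite E1 E2 opprD addrACA subrr add0r.
have H1 : (1 - q) * N (u1 - u2) <= N (r1 - r2).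
  have := ND (u1 - u2 - M *m (u1 - u2)) (M *m (u1 - u2)); rewrite subrK E.
  by have := Mq (u1 - u2); set a := N _; set b := N _; set c := N _; lra.
have H2 : N (r1 - r2) <= C * (2 * (e / (B + 1) * (L * `|v|))).
  rewrite (le_trans (NC _))// ler_pM2l// (le_trans (ler_normB _ _))//.
  by move: r1e r2e; set a := `|_|; set b := `|_|; set c := _ * _; lra.
rewrite (le_trans (DN _))// -ler_pdivlMl//.
have := le_trans H1 H2; rewrite mulrC -ler_pdivlMr// => /le_trans; apply.
rewrite [leRHS]mulrC ler_pdivlMr// mulrC.
have -> : D * (C * (2 * (e / (B + 1) * (L * `|v|))) / (1 - q)) = e * (B / (B + 1)).
  rewrite [in X in _ = _ * (X / _)]BE [in X in _ = _ * (X * _ / _)]LE; field.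
  by rewrite !gt_eqF// ltr_wpDl.
by rewrite ler_piMr ?(ltW e0)// ler_pdivrMr ?mul1r ?lerDl// ltr_wpDl.
Qed.

End StrictDifferentiability.

(** * Calculus along the real line and mean value inequalities for an arbitrary norm *)

Section Calculus.
Set Implicit Arguments. Unset Strict Implicit. Unset Printing Implicit Defensive.

Lemma within_continuous_epsdelta (R : realType) (V W : normedModType R)
    (A : set V) (f : V -> W) :
  {within A, continuous f} <-> (forall x, A x -> forall e : R, 0 < e ->
    exists2 d, 0 < d & forall y, A y -> `|y - x| < d -> `|f y - f x| < e).
Proof.
rewrite subspace_continuousP; split=> H x Ax.
  move=> e e0; have /cvgrPdistC_lt/(_ _ e0) := H x Ax.
  rewrite near_withinE => /nbhs_normP[d /= d0 Hd]; exists d => // y Ay yx.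
  by apply: Hd => //=; rewrite distrC.
apply/cvgrPdistC_lt => e e0; rewrite near_withinE.
have [d d0 Hd] := H x Ax e e0; apply/nbhs_normP; exists d => //= y /=.
by rewrite distrC => yx Ay; exact: Hd.
Qed.

Lemma within_continuous_coord (R : realType) (V : normedModType R) (A : set V)
    m p (M : V -> 'M[R]_(m, p)) i j :
  {within A, continuous M} -> {within A, continuous (fun x => M x i j)}.
Proof.
move=> /within_continuous_epsdelta cM; apply/within_continuous_epsdelta.
move=> x Ax e e0; have [d d0 Hd] := cM x Ax e e0; exists d => // y Ay yx.
rewrite (le_lt_trans _ (Hd y Ay yx))//.
by have := mx_entry_le_norm (M y - M x) i j; rewrite !mxE.
Qed.

Lemma is_derive_epsdelta (R : realType) (W : normedModType R) (f : R -> W)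
    (x : R) (l : W) :
  is_derive x 1 f l <-> (forall e : R, 0 < e -> exists2 d, 0 < d &
    forall h, `|h| < d -> `|f (x + h) - f x - h *: l| <= e * `|h|).
Proof.
have E (h : R) : f (h *: 1 + x) = f (x + h).
  by rewrite /GRing.scale/= mulr1 addrC.
have aux (h : R) (u : W) (e : R) : h != 0 ->
    (`|l - h^-1 *: u| <= e) = (`|u - h *: l| <= e * `|h|).
  move=> h0; rewrite -ler_pdivrMr ?normr_gt0// mulrC -normfV -normrZ distrC.
  by rewrite scalerBr scalerA mulVf// scale1r.
split=> [[dfx fl] e e0|H].
  have /cvgrPdist_le/(_ _ e0) : h^-1 *: ((f \o shift x) (h *: 1) - f x)
      @[h --> 0^'] --> l.
    by rewrite -fl; exact: dfx.
  rewrite near_withinE => /nbhs_normP[d /= d0 Hd]; exists d => // h hd.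
  have [->|h0] := eqVneq h 0.
    by rewrite addr0 scale0r subrr subr0 !normr0 mulr0.
  by have := Hd h; rewrite /= sub0r normrN E aux//; exact.
have fl : h^-1 *: ((f \o shift x) (h *: 1) - f x) @[h --> 0^'] --> l.
  apply/cvgrPdist_le => e e0; rewrite near_withinE.
  have [d d0 Hd] := H e e0; apply/nbhs_normP; exists d => //= h /=.
  by rewrite sub0r normrN => hd h0; rewrite E aux// Hd.
by split; [apply/cvg_ex; exists l|exact: cvg_lim].
Qed.

Lemma is_derive_mx (R : realType) m p (M : R -> 'M[R]_(m, p)) (x : R) D :
  is_derive x 1 M D <-> forall i j, is_derive x 1 (fun y => M y i j) (D i j).
Proof.
split=> [[dM ME] i j|H].
  have dMij : derivable (fun y => M y i j) x 1 by exact: (derivable_mxP M x 1).1.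
  by apply: DeriveDef => //; rewrite -ME derive_mx// mxE.
have dM : derivable M x 1 by apply/derivable_mxP => i j; case: (H i j).
apply: DeriveDef => //; rewrite derive_mx//.
by apply/matrixP => i j; rewrite mxE; case: (H i j).
Qed.

Lemma is_derive_mulmx (R : realType) m p q (M : R -> 'M[R]_(m, p))
    (L : R -> 'M[R]_(p, q)) (x : R) dM dL :
  is_derive x 1 M dM -> is_derive x 1 L dL ->
  is_derive x 1 (fun y => M y *m L y) (dM *m L x + M x *m dL).
Proof.
move=> /is_derive_mx HM /is_derive_mx HL; apply/is_derive_mx => i j.
have -> : (fun y => (M y *m L y) i j) =
    \sum_(k < p) ((fun y => M y i k) * (fun y => L y k j)).
  by apply/funext => y; rewrite mxE fct_sumE.
have H k : is_derive x 1 ((fun y => M y i k) * (fun y => L y k j))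
    (M x i k * dL k j + L x k j * dM i k).
  exact: is_deriveM.
apply: is_derive_eq; rewrite !mxE -big_split/=; apply: eq_bigr => k _.
by rewrite addrC; congr (_ + _); rewrite mulrC.
Qed.

Lemma within_continuous_mulmx (R : realType) (V : normedModType R) (A : set V)
    m p q (M : V -> 'M[R]_(m, p)) (L : V -> 'M[R]_(p, q)) :
  {within A, continuous M} -> {within A, continuous L} ->
  {within A, continuous (fun y => M y *m L y)}.
Proof.
move=> /within_continuous_epsdelta HM /within_continuous_epsdelta HL.
apply/within_continuous_epsdelta => x Ax e e0.
pose b := p%:R * (`|M x| + `|L x| + 1) + 1.
have b0 : 0 < b by rewrite ltr_wpDl// mulr_ge0// !addr_ge0.
pose e' := Num.min 1 (e / 2 / b).
have e'0 : 0 < e' by rewrite lt_min ltr01 !divr_gt0.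
have e'b : e' * b <= e / 2.
  by rewrite -ler_pdivlMr// ge_min lexx orbT.
have e'1 : e' <= 1 by rewrite ge_min lexx.
have [d1 d10 H1] := HM x Ax e' e'0; have [d2 d20 H2] := HL x Ax e' e'0.
exists (Num.min d1 d2); first by rewrite lt_min d10.
move=> y Ay; rewrite lt_min => /andP[yd1 yd2].
have {}H1 := ltW (H1 y Ay yd1); have {}H2 := ltW (H2 y Ay yd2).
have -> : M y *m L y - M x *m L x = (M y - M x) *m (L y - L x) +
    (M y - M x) *m L x + M x *m (L y - L x).
  by rewrite !(mulmxBl, mulmxBr); move: (M y *m L y) (M y *m L x) (M x *m L y)
    (M x *m L x) => a1 a2 a3 a4; apply/matrixP => i j; rewrite !mxE; ring.
have L3 : `|(M y - M x) *m (L y - L x)| <= p%:R * e' * e'.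
  by rewrite (le_trans (mulmx_norm_le _ _))// -!mulrA ler_wpM2l// ler_pM.
have L4 : `|(M y - M x) *m L x| <= p%:R * e' * `|L x|.
  by rewrite (le_trans (mulmx_norm_le _ _))// -!mulrA ler_wpM2l// ler_wpM2r.
have L5 : `|M x *m (L y - L x)| <= p%:R * `|M x| * e'.
  by rewrite (le_trans (mulmx_norm_le _ _))// -!mulrA ler_wpM2l// ler_wpM2l.
rewrite (le_lt_trans (ler_normD _ _))//.
rewrite (le_lt_trans (lerD (ler_normD _ _) (lexx _)))//.
rewrite (le_lt_trans (lerD (lerD L3 L4) L5))//.
apply: le_lt_trans (_ : e' * b < e); last first.
  by rewrite (le_lt_trans e'b)// ltr_pdivrMr//; lra.
rewrite /b mulrDr mulr1 ler_wpDr ?(ltW e'0)//.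
have -> : p%:R * e' * e' + p%:R * e' * `|L x| + p%:R * `|M x| * e' =
   e' * (p%:R * (`|M x| + `|L x| + e')) by ring.
by rewrite ler_wpM2l ?(ltW e'0)// ler_wpM2l// lerD2l.
Qed.

Section MeanValue.
Context {R : realType} {n : nat}.
Local Notation vec := 'cV[R]_n.

(** No derivative of [N (z r - z p)] is taken. With an extra slope [tau], the minimum of [phi] can
    only lie at [q], since anywhere earlier a short step to the right would lower [phi]; then
    [phi q <= phi p] is the claim up to [tau]. *)
Lemma mean_value_closed (N : vec -> R) (z dz : R -> vec) (B dB : R -> R) (p q : R) :
  is_norm N -> p <= q ->
  (forall s, p <= s <= q -> is_derive s 1 z (dz s)) ->
  (forall s, p <= s <= q -> is_derive s 1 B (dB s)) ->
  (forall s, p <= s <= q -> N (dz s) <= dB s) ->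
  N (z q - z p) <= B q - B p.
Proof.
move=> hN pq Hz HB Hzb; have [N0 NI NZ ND] := hN.
have [C C0 NC] := is_norm_upper hN.
suff H tau : 0 < tau -> N (z q - z p) <= B q - B p + tau * (q - p).
  have [<-|qp] := eqVneq p q; first by rewrite !subrr is_norm0.
  have qp0 : 0 < q - p by rewrite subr_gt0 lt_neqAle qp.
  apply/ler_addgt0Pr => e e0; have := H (e / (q - p)) (divr_gt0 e0 qp0).
  by rewrite divfK// gt_eqF.
move=> tau0; pose phi r := N (z r - z p) - B r - tau * r.
have ders (g : R -> vec) (dg : vec) (s : R) : is_derive s 1 g dg -> {for s, continuous g}.
  by move=> [dg1 _]; apply: differentiable_continuous; exact/derivable1_diffP.
have derB s : p <= s <= q -> {for s, continuous B}.
  by move=> /HB[dg1 _]; apply: differentiable_continuous; exact/derivable1_diffP.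
have cphi : {within `[p, q], continuous phi}.
  apply: continuous_in_subspaceT => s; rewrite inE/= in_itv/= => spq.
  have -> : phi = (fun r => N (z r - z p)) - B - (fun r => tau * r) by [].
  apply: continuousB; last first.
    by apply: continuousM; [exact: cst_continuous|exact: cvg_id].
  apply: continuousB; last exact: derB.
  apply: (@continuous_comp _ _ _ (z - cst (z p)) N).
    by apply: continuousB; [exact: ders (Hz _ spq)|exact: cst_continuous].
  exact: is_norm_continuous.
have [x xpq xmin] := EVT_min pq cphi; move: (xpq); rewrite in_itv/= => /andP[px xq].
have [xE|xq'] := eqVneq x q.
  have := xmin p; rewrite in_itv/= lexx pq => /(_ isT).
  by rewrite xE /phi subrr is_norm0//; move: (N _) => a; lra.
exfalso; have {xq'}xq' : x < q by rewrite lt_neqAle xq'.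
have xpq' : p <= x <= q by rewrite px.
(* Over a step [h] the first-order errors are [C * e * h] for [z] and [e * h] for [B], together half
   of [tau * h]. *)
pose e := tau / (2 * (C + 1)).
have C10 : 0 < C + 1 by rewrite addr_gt0.
have e0 : 0 < e by rewrite divr_gt0// mulr_gt0.
have eE : e * (C + 1) * 2 = tau by rewrite /e; field; rewrite gt_eqF.
have /is_derive_epsdelta/(_ _ e0)[d1 d10 Hd1] := Hz x xpq'.
have /is_derive_epsdelta/(_ _ e0)[d2 d20 Hd2] := HB x xpq'.
have m0 : 0 < Num.min (Num.min d1 d2) (q - x) by rewrite !lt_min d10 d20 subr_gt0.
pose h := Num.min (Num.min d1 d2) (q - x) / 2.
have h0 : 0 < h by rewrite divr_gt0.
have hm : h < Num.min (Num.min d1 d2) (q - x) by rewrite ltr_pdivrMr//; lra.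
move: hm; rewrite !lt_min => /andP[/andP[hd1 hd2] hqx].
have := Hd1 h; rewrite gtr0_norm// => /(_ hd1) H1.
have := Hd2 h; rewrite gtr0_norm// => /(_ hd2).
rewrite /GRing.scale/= => /ler_normlP[H2 H2'].
have := xmin (x + h); rewrite in_itv/= (_ : p <= x + h <= q); last first.
  by apply/andP; split; lra.
move=> /(_ isT); rewrite /phi leNgt => /negP; apply.
have K1 : N (z (x + h) - z p) <= N (z (x + h) - z x) + N (z x - z p).
  by have := ND (z (x + h) - z x) (z x - z p); rewrite subrKA.
have K2 : N (z (x + h) - z x) <= C * (e * h) + h * N (dz x).
  have := ND (z (x + h) - z x - h *: dz x) (h *: dz x); rewrite subrK.
  move=> /le_trans; apply; rewrite lerD ?NZ ?gtr0_norm//.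
  by rewrite (le_trans (NC _))// ler_pM2l.
have K3 := Hzb x xpq'.
have K4 : h * N (dz x) <= h * dB x by rewrite ler_pM2l.
have K5 : (e * (C + 1) * 2) * h = tau * h by rewrite eE.
have K6 : 0 < e * h by rewrite mulr_gt0.
have K7 : 0 < C * (e * h) by rewrite mulr_gt0.
move: K1 K2 K4 K5 K6 K7 H2 H2'.
move: (N (z (x + h) - z p)) (N (z (x + h) - z x)) (N (z x - z p)) => a1 a2 a3.
move: (h * N (dz x)) (h * dB x) (B (x + h)) (B x) => a4 a5 a6 a7.
by move: (h) (e) (tau) (C) => ? ? ? ?; lra.
Qed.

(** Solutions are differentiable only at positive times, so derivatives are required on the open
    interval. The closed version applies on [[p + h, q - h]], and continuity bridges the two end
    gaps. *)
Lemma mean_value_norm (N : vec -> R) (z dz : R -> vec) (B dB : R -> R) (p q : R) :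
  is_norm N -> p <= q ->
  {within `[p, q], continuous z} -> {within `[p, q], continuous B} ->
  (forall s, p < s < q -> is_derive s 1 z (dz s)) ->
  (forall s, p < s < q -> is_derive s 1 B (dB s)) ->
  (forall s, p < s < q -> N (dz s) <= dB s) ->
  N (z q - z p) <= B q - B p.
Proof.
move=> hN; rewrite le_eqVlt => /predU1P[<- *|pq cz cB Hz HB Hzb].
  by rewrite !subrr is_norm0.
have [N0 NI NZ ND] := hN; have [C C0 NC] := is_norm_upper hN.
apply/ler_addgt0Pr => e e0.
(* Each end gap costs [C * e'] for [z] and [e'] for [B]. *)
pose e' := e / (2 * (C + 1)); have C10 : 0 < C + 1 by rewrite addr_gt0.
have e'0 : 0 < e' by rewrite divr_gt0// mulr_gt0.
have eE : e = e' * (C + 1) * 2 by rewrite /e'; field; rewrite gt_eqF.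
have mem s : p <= s <= q -> `[p, q]%classic s by rewrite /= in_itv.
have pE : p <= p <= q by rewrite lexx ltW.
have qE : p <= q <= q by rewrite lexx ltW.
move/within_continuous_epsdelta : cz => cz.
move/within_continuous_epsdelta : cB => cB.
have [d1 d10 H1] := cz _ (mem _ pE) _ e'0.
have [d2 d20 H2] := cB _ (mem _ pE) _ e'0.
have [d3 d30 H3] := cz _ (mem _ qE) _ e'0.
have [d4 d40 H4] := cB _ (mem _ qE) _ e'0.
pose d := Num.min (Num.min (Num.min d1 d2) (Num.min d3 d4)) (q - p).
have d0 : 0 < d by rewrite !lt_min d10 d20 d30 d40 subr_gt0.
pose h := d / 3.
have h0 : 0 < h by rewrite divr_gt0.
have hd : h < d by rewrite ltr_pdivrMr//; lra.
have h3 : h * 3 <= q - p by rewrite divfK ?ge_min ?lexx ?orbT// pnatr_eq0.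
move: hd; rewrite !lt_min => /andP[/andP[/andP[hd1 hd2] /andP[hd3 hd4]] hqp].
have mp : p <= p + h <= q by apply/andP; split; lra.
have mq : p <= q - h <= q by apply/andP; split; lra.
have hN1 : `|p + h - p| = h by rewrite addrC addKr gtr0_norm.
have hN2 : `|q - h - q| = h by rewrite addrC addKr normrN gtr0_norm.
have := H1 (p + h) (mem _ mp); rewrite hN1 => /(_ hd1) K1.
have := H2 (p + h) (mem _ mp); rewrite hN1 => /(_ hd2) K2.
have := H3 (q - h) (mem _ mq); rewrite hN2 => /(_ hd3) K3.
have := H4 (q - h) (mem _ mq); rewrite hN2 => /(_ hd4) K4.
have K5 : N (z (q - h) - z (p + h)) <= B (q - h) - B (p + h).
  apply: (@mean_value_closed N z dz B dB) => //; first by lra.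
  - by move=> s /andP[s1 s2]; apply: Hz; apply/andP; split; lra.
  - by move=> s /andP[s1 s2]; apply: HB; apply/andP; split; lra.
  - by move=> s /andP[s1 s2]; apply: Hzb; apply/andP; split; lra.
have K6 : N (z (p + h) - z p) <= C * e'.
  by rewrite (le_trans (NC _))// ler_pM2l// ltW.
have K7 : N (z q - z (q - h)) <= C * e'.
  by rewrite (le_trans (NC _))// ler_pM2l// distrC ltW.
have K8 := ND (z q - z (q - h)) (z (q - h) - z p); rewrite subrKA in K8.
have K9 := ND (z (q - h) - z (p + h)) (z (p + h) - z p); rewrite subrKA in K9.
have /ltr_normlP[K2a K2b] := K2; have /ltr_normlP[K4a K4b] := K4.
rewrite eE; move: K5 K6 K7 K8 K9 K2a K2b K4a K4b e'0; clear.
move: (N _) (N _) (N _) (N _) (N _) => a1 a2 a3 a4 a5.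
move: (B _) (B _) (B _) (B _) (e') (C) => b1 b2 b3 b4 ? ?; lra.
Qed.


End MeanValue.
End Calculus.

(** * Gronwall's inequality on a compact interval, forward and backward in time *)

Section Gronwall.
Set Implicit Arguments. Unset Strict Implicit. Unset Printing Implicit Defensive.
Context {R : realType} {n : nat}.
Local Notation vec := 'cV[R]_n.

Lemma gronwall_scalar (phi dphi : R -> R) (D T : R) :
  0 <= D -> {within `[0, T], continuous phi} ->
  (forall r, 0 < r < T -> is_derive r 1 phi (dphi r)) ->
  (forall r, 0 <= r <= T -> 0 <= phi r) ->
  (forall r, 0 < r < T -> `|dphi r| <= D * phi r) ->
  forall s t, 0 <= s <= T -> 0 <= t <= T -> phi s <= expR (D * T) * phi t.
Proof.
move=> D0 cphi Hphi phi0 Hb.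
(* [phi r * expR (c * r)] is monotone for [c = D] and [c = - D]. *)
have der c r : 0 < r < T -> is_derive r 1 (fun r => phi r * expR (c * r))
    ((dphi r + c * phi r) * expR (c * r)).
  move=> rT; have H1 := Hphi r rT.
  have H2 : is_derive r 1 (fun r => expR (c * r)) (c * expR (c * r)).
    by apply: is_derive_eq; rewrite /GRing.scale/=; ring.
  rewrite (_ : (fun r => _) = phi * (fun r => expR (c * r)))//.
  by apply: is_derive_eq; rewrite /GRing.scale/=; ring.
have cont c s t : 0 <= s -> t <= T ->
    {within `[s, t], continuous (fun r => phi r * expR (c * r))}.
  move=> s0 tT; have : {within `[s, t], continuous phi}.
    by apply: continuous_subspaceW cphi; exact: subset_itv.
  rewrite (_ : (fun r => _) = phi * (fun r => expR (c * r)))// => cphi' r.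
  apply: continuousM; first exact: cphi'.
  apply: continuous_subspaceT => u.
  apply: (@continuous_comp _ _ _ (fun r => c * r) expR).
    by apply: continuousM; [exact: cst_continuous|exact: cvg_id].
  exact: continuous_expR.
move=> s t /andP[s0 sT] /andP[t0 tT].
have [st|ts|->] := ltgtP s t; last 1 first.
- by rewrite ler_peMl ?phi0 ?t0// -expR0 ler_expR mulr_ge0// (le_trans t0).
- have dst r : r \in `]s, t[ -> is_derive r 1 (fun r => phi r * expR (D * r))
      ((dphi r + D * phi r) * expR (D * r)).
    rewrite in_itv/= => /andP[sr rt]; apply: der.
    by rewrite (le_lt_trans s0 sr) (lt_le_trans rt).
  have [c cst] := MVT st dst (cont D s t s0 tT).
  move: cst; rewrite in_itv/= => /andP[sc ct] E.
  have cT : 0 < c < T by rewrite (le_lt_trans s0 sc) (lt_le_trans ct).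
  have /ler_normlP[H1 _] := Hb c cT.
  have E0 : 0 <= phi t * expR (D * t) - phi s * expR (D * s).
    rewrite E !mulr_ge0 ?expR_ge0 ?subr_ge0 ?(ltW st)//.
    by move: H1; set a := dphi c; set b := _ * _; lra.
  rewrite subr_ge0 in E0.
  rewrite (@le_trans _ _ (phi s * expR (D * s)))//.
    by rewrite ler_peMr ?phi0 ?s0// -expR0 ler_expR mulr_ge0.
  by rewrite (le_trans E0)// mulrC ler_wpM2r ?phi0 ?t0// ler_expR ler_wpM2l.
- have dst r : r \in `]t, s[ -> is_derive r 1 (fun r => phi r * expR ((- D) * r))
      ((dphi r + (- D) * phi r) * expR ((- D) * r)).
    rewrite in_itv/= => /andP[sr rt]; apply: der.
    by rewrite (le_lt_trans t0 sr) (lt_le_trans rt).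
  have [c cst] := MVT ts dst (cont (- D) t s t0 sT).
  move: cst; rewrite in_itv/= => /andP[sc ct] E.
  have cT : 0 < c < T by rewrite (le_lt_trans t0 sc) (lt_le_trans ct).
  have /ler_normlP[_ H1] := Hb c cT.
  have E0 : phi s * expR (- D * s) - phi t * expR (- D * t) <= 0.
    rewrite E mulr_le0_ge0 ?subr_ge0 ?(ltW ts)//.
    rewrite mulr_le0_ge0 ?expR_ge0//.
    by move: H1; set a := dphi c; rewrite mulNr; set b := _ * _; lra.
  rewrite subr_le0 in E0.
  have -> : phi s = phi s * expR (- D * s) * expR (D * s).
    by rewrite -mulrA -expRD mulNr addNr expR0 mulr1.
  rewrite mulrC ler_pM ?expR_ge0 ?mulr_ge0 ?expR_ge0 ?phi0 ?s0//.
    by rewrite ler_expR ler_wpM2l.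
  rewrite (le_trans E0)// ler_piMr ?phi0 ?t0// -expR0 ler_expR mulNr oppr_le0.
  by rewrite mulr_ge0.
Qed.

Lemma norm_sqr_le_sum (w : vec) : `|w| ^+ 2 <= \sum_i w i ord0 ^+ 2.
Proof.
have S0 : 0 <= \sum_i w i ord0 ^+ 2 by apply: sumr_ge0 => i _; exact: sqr_ge0.
rewrite -(sqr_sqrtr S0) ler_sqr ?nnegrE ?sqrtr_ge0//.
apply: mx_norm_le => [|i j]; first exact: sqrtr_ge0.
rewrite -sqrtr_sqr ler_sqrt// (ord1 j) (bigD1 i)//= lerDl.
by apply: sumr_ge0 => k _; exact: sqr_ge0.
Qed.

Lemma sum_sqr_le_norm (w : vec) : \sum_i w i ord0 ^+ 2 <= n%:R * `|w| ^+ 2.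
Proof.
have -> : n%:R * `|w| ^+ 2 = \sum_(i < n) `|w| ^+ 2.
  by rewrite sumr_const card_ord -[RHS]mulr_natl.
apply: ler_sum => i _; rewrite -real_normK ?num_real//.
by rewrite ler_sqr ?nnegrE// mx_entry_le_norm.
Qed.

(** The exponent is the rate for a sum of squares, and [n.+1] pays for comparing it with the maximum
    norm. The constant bounds squares of norms; no square root is taken, as it is at least 1 for
    nonnegative [C] and [T]. *)
Definition gronwall_cst (C T : R) : R :=
  expR ((2 * n%:R * C + n%:R) * T) * n.+1%:R.

(** The maximum norm is not differentiable, but the sum of squares is. Adding [k ^+ 2] absorbs the
    forcing, because [2 * |w| * k <= |w| ^+ 2 + k ^+ 2], so the scalar inequality applies to
    [phi]. *)
Lemma gronwall (w dw : R -> vec) (C k T : R) :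
  0 <= C -> 0 <= k -> {within `[0, T], continuous w} ->
  (forall r, 0 < r < T -> is_derive r 1 w (dw r)) ->
  (forall r, 0 < r < T -> `|dw r| <= C * `|w r| + k) ->
  forall s t, 0 <= s <= T -> 0 <= t <= T ->
  `|w s| <= gronwall_cst C T * (`|w t| + k).
Proof.
move=> C0 k0 cw Hw Hb s t sT tT.
pose phi r := \sum_i w r i ord0 ^+ 2 + k ^+ 2.
pose dphi r := \sum_i 2 * (w r i ord0 * dw r i ord0).
pose D := 2 * n%:R * C + n%:R.
have D0 : 0 <= D by rewrite addr_ge0// !mulr_ge0.
have T0 : 0 <= T by case/andP: sT => /le_trans; exact.
have phiE : phi = \sum_i (fun r => w r i ord0) ^+ 2 + cst (k ^+ 2).
  apply/funext => r; rewrite /phi [RHS]/GRing.add/= fct_sumE.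
  by congr (_ + _); apply: eq_bigr => i _; rewrite fctE.
have cphi : {within `[0, T], continuous phi}.
  rewrite phiE => r; apply: continuousD; last exact: cst_continuous.
  move: r; elim/big_ind : _ => [|f g cf cg r|i _].
  - exact: cst_continuous.
  - by apply: continuousD; [exact: cf|exact: cg].
  - have ci := within_continuous_coord (i:=i) (j:=ord0) cw.
    by move=> r; apply: continuousM; exact: ci.
have H := @gronwall_scalar phi dphi D T D0 cphi.
have {}H : phi s <= expR (D * T) * phi t.
  apply: H => //.
  - move=> r rT; have /is_derive_mx Hwr := Hw r rT.
    have Hi i : is_derive r 1 ((fun r => w r i ord0) ^+ 2)
        (2 * (w r i ord0 * dw r i ord0)).
      have Hwi := Hwr i ord0; apply: is_derive_eq.
      by rewrite /GRing.scale/= expr1; ring.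
    rewrite phiE; apply: is_derive_eq; by rewrite addr0.
  - by move=> r _; rewrite addr_ge0 ?sqr_ge0// sumr_ge0// => i _; exact: sqr_ge0.
  - move=> r rT; have Hbr := Hb r rT.
    have A1 : `|dphi r| <= n%:R * (2 * (`|w r| * (C * `|w r| + k))).
      have -> : n%:R * (2 * (`|w r| * (C * `|w r| + k))) =
          \sum_(i < n) 2 * (`|w r| * (C * `|w r| + k)).
        by rewrite sumr_const card_ord -[RHS]mulr_natl.
      rewrite (le_trans (ler_norm_sum _ _ _))// ler_sum// => i _.
      rewrite !normrM ger0_norm// ler_pM2l// ler_pM// ?mx_entry_le_norm//.
      by rewrite (le_trans _ Hbr)// mx_entry_le_norm.
    have A2 := norm_sqr_le_sum (w r).
    rewrite (le_trans A1)// /D /phi.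
    have A3 : 0 <= (`|w r| - k) ^+ 2 by exact: sqr_ge0.
    have A4 : 2 * (`|w r| * (C * `|w r| + k)) <=
       (2 * C + 1) * (\sum_i w r i ord0 ^+ 2 + k ^+ 2).
      have A5 := mulr_ge0 C0 (sqr_ge0 k).
      have A6 := ler_wpM2l C0 A2.
      move: A2 A3 A5 A6; rewrite !expr2; move: (\sum_i _) `|w r| => S a.
      by move: C0; clear; move: (C) (k) => c l; nra.
    have := ler_wpM2l (ler0n R n) A4; move: (_ * _) => u.
    by congr (_ <= _); ring.
have n1 : 1 <= n.+1%:R :> R by rewrite ler1n.
have E1 : 1 <= expR (D * T) by rewrite -expR0 ler_expR mulr_ge0.
have F0 : 0 <= gronwall_cst C T * (`|w t| + k).
  by rewrite mulr_ge0 ?addr_ge0// mulr_ge0// expR_ge0.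
rewrite -(@ler_sqr _ `|w s|) ?nnegrE//.
rewrite (le_trans (norm_sqr_le_sum _))//.
rewrite (@le_trans _ _ (phi s)) ?lerDl ?sqr_ge0// (le_trans H)//.
rewrite /gronwall_cst -/D.
have G : phi t <= n.+1%:R * (`|w t| + k) ^+ 2.
  rewrite /phi -natr1 mulrDl mul1r.
  have := sum_sqr_le_norm (w t).
  have W0 := normr_ge0 (w t).
  have B1 : `|w t| ^+ 2 <= (`|w t| + k) ^+ 2 by rewrite ler_sqr ?nnegrE ?addr_ge0// lerDl.
  have B2 : k ^+ 2 <= (`|w t| + k) ^+ 2 by rewrite ler_sqr ?nnegrE ?addr_ge0// lerDr.
  have := ler_wpM2l (ler0n R n) B1.
  move: B2; move: (_ ^+ 2) (_ ^+ 2) (_ * _) (_ * _) (\sum_i _) => a1 a2 a3 a4 a5.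
  lra.
rewrite (le_trans (ler_wpM2l (expR_ge0 _) G))// mulrA exprMn.
rewrite ler_wpM2r ?sqr_ge0// expr2 ler_peMr// ?mulr_ge0 ?expR_ge0//.
by rewrite -[leLHS]mulr1 ler_pM.
Qed.


End Gronwall.

(** * The derivative of the field along a solution, and crude dependence on initial data *)

Section Flow.
Set Implicit Arguments. Unset Strict Implicit. Unset Printing Implicit Defensive.
Context {R : realType} {n : nat}.
Local Notation vec := 'cV[R]_n.
Local Notation mat := 'M[R]_n.

Lemma within_continuous_mx (V : normedModType R) (E : set V) m p
    (M : V -> 'M[R]_(m, p)) :
  (forall i j, {within E, continuous (fun x => M x i j)}) ->
  {within E, continuous M}.
Proof.
move=> cM; apply/subspace_continuousP => x Ex.
apply/cvgrPdist_le => e e0.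
have H : \forall y \near within E (nbhs x), forall ij : 'I_m * 'I_p,
    `|M x ij.1 ij.2 - M y ij.1 ij.2| <= e.
  apply: filter_forall => -[i j] /=.
  by have /subspace_continuousP/(_ x Ex)/cvgrPdist_le/(_ _ e0) := cM i j.
apply: filterS H => y H; apply: mx_norm_le => [|i j]; first exact: ltW.
by rewrite !mxE; exact: (H (i, j)).
Qed.

Lemma continuous_half_line_segment (W : normedModType R) (g : R -> W) (T : R) :
  {within `[0, +oo[, continuous g} -> {within `[0, T], continuous g}.
Proof. by apply: continuous_subspaceW => x; rewrite /= !in_itv/= => /andP[->]. Qed.

Lemma segment_bounded_norm (W : normedModType R) (g : R -> W) (T : R) :
  {within `[0, T], continuous g} ->
  exists2 C, 0 <= C & forall s, 0 <= s <= T -> `|g s| <= C.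
Proof.
have [T0|T0] := ltP T 0.
  move=> _; exists 0 => // s /andP[s0 sT].
  by have := le_lt_trans (le_trans s0 sT) T0; rewrite ltxx.
move=> /within_continuous_epsdelta cg0.
have cg : {within `[0, T], continuous (fun s => `|g s|)}.
  apply/within_continuous_epsdelta => s sT e e0.
  have [d d0 Hd] := cg0 s sT e e0; exists d => // r rT rs.
  by rewrite (le_lt_trans (ler_dist_dist _ _))// Hd.
have [c _ cmax] := EVT_max T0 cg.
by exists `|g c| => // s sT; apply: cmax; rewrite in_itv.
Qed.

Section OnePoint.
Variables (f : R -> vec -> vec).
Hypothesis df : forall t x, 0 <= t -> differentiable (f t) x.
Hypothesis cdf : forall v : vec, {within [set p : R * vec | 0 <= p.1],
  continuous (fun p => d2 f p.1 p.2 v)}.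

(** Continuity of the derivative is given one direction at a time; as a matrix it can be bounded and
    compared in norm. *)
Definition jac (s : R) (x : vec) : mat :=
  \matrix_(i, j) d2 f s x (delta_mx j ord0) i ord0.

Lemma jacE s x v : 'd (f s) x v = jac s x *m v.
Proof.
rewrite [in LHS](cV_sum_delta v) linear_sum/=; apply/colP => i.
rewrite summxE [RHS]mxE; apply: eq_bigr => j _.
by rewrite linearZ/= !mxE mulrC.
Qed.

Lemma jac_continuous : {within [set p : R * vec | 0 <= p.1],
  continuous (fun p => jac p.1 p.2)}.
Proof.
apply: within_continuous_mx => i j.
have -> : (fun p : R * vec => jac p.1 p.2 i j) =
    (fun p => d2 f p.1 p.2 (delta_mx j ord0) i ord0).
  by apply/funext => p; rewrite mxE.
exact: (@within_continuous_coord _ _ _ _ _ _ i ord0 (@cdf (delta_mx j ord0))).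
Qed.

Lemma is_derive_line s x w (tau : R) : 0 <= s ->
  is_derive tau 1 (fun u => f s (x + u *: w)) (jac s (x + tau *: w) *m w).
Proof.
move=> s0; rewrite -jacE; pose l (u : R) : vec := x + u *: w.
have dl : is_derive tau 1 l w.
  apply/is_derive_epsdelta => e e0; exists 1 => // h _.
  rewrite /l scalerDl addrA (addrC _ (h *: w)) addrK subrr normr0.
  by rewrite mulr_ge0// ltW.
have dl' : differentiable l tau by apply/derivable1_diffP; case: dl.
have dfl : differentiable (f s \o l) tau.
  by apply: differentiable_comp => //; exact: df.
apply: DeriveDef; first exact/derivable1_diffP.
rewrite deriveE// diff_comp//=; last exact: df.
have E : 'd l tau 1 = w by case: dl => _ <-; rewrite deriveE.
by rewrite -/l E.
Qed.

(** Joint continuity of the Jacobian at each [(s0, y s0)] gives a local radius; compactness of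
    [[0, T]] makes it uniform along the curve. *)
Lemma jac_uniform (y : R -> vec) (T : R) : {within `[0, T], continuous y} ->
  forall e : R, 0 < e -> exists2 d, 0 < d & forall s x, 0 <= s <= T ->
    `|x - y s| < d -> `|jac s x - jac s (y s)| <= e.
Proof.
move=> cy e e0.
pose P (d s : R) := forall x, `|x - y s| < d -> `|jac s x - jac s (y s)| <= e.
suff H : \forall d \near (0 : R)^'+, `[0, T]%classic `<=` P d.
  have [d [d0 Hd]] : exists d : R, 0 < d /\ `[0, T]%classic `<=` P d.
    apply: (@filter_ex _ ((0 : R)^'+)); apply: filterI => //.
    exact: nbhs_right_gt.
  by exists d => // s x sT; apply: Hd; rewrite /= in_itv.
have /compact_near_coveringP/near_covering_withinP := @segment_compact R 0 T.
apply=> s0 s0T; have /andP[s00 _] : 0 <= s0 <= T by move: s0T; rewrite /= in_itv.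
have e20 : 0 < e / 2 by rewrite divr_gt0.
have /within_continuous_epsdelta/(_ (s0, y s0) s00 _ e20)[d d0 Hd] :=
  jac_continuous.
have d20 : 0 < d / 2 by rewrite divr_gt0.
have dd : d / 2 < d by rewrite ltr_pdivrMr//; lra.
move/within_continuous_epsdelta: cy => /(_ s0 s0T _ d20)[d' d'0 Hd'].
exists ([set s | `|s - s0| < Num.min d' d], [set u | u < d / 2]).
  split=> /=.
    apply/nbhs_normP; exists (Num.min d' d); first by rewrite /= lt_min d'0.
    by move=> s /=; rewrite distrC.
  exact: nbhs_right_lt.
move=> [s u] /= [ss0 ud] sT x xu.
have s_ge0 : 0 <= s by move: sT; rewrite in_itv/= => /andP[].
move: ss0; rewrite lt_min => /andP[ss0' ss0].
have ys := Hd' s sT ss0'.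
have near_d x' : `|x' - y s| < d / 2 -> `|jac s x' - jac s0 (y s0)| < e / 2.
  move=> x's; apply: (Hd (s, x')) => //.
  rewrite /Num.Def.normr/= gt_max ss0/=.
  rewrite (le_lt_trans (ler_distD (y s) _ _))//.
  by rewrite [ltRHS](splitr d) ltrD.
have H1 := near_d _ (lt_trans xu ud).
have := near_d (y s); rewrite subrr normr0 => /(_ d20) H2.
move: H1 H2; move: (jac s x) (jac s (y s)) (jac s0 (y s0)) => a b c H1 H2.
rewrite (le_trans (ler_distD c _ _))// (splitr e) lerD ?(ltW H1)//.
by rewrite distrC ltW.
Qed.

(** Subtract the linear part and apply the mean value inequality on the segment from [x2] to [x1];
    balls are convex, so the segment stays in the uniform tube around the curve. *)
Lemma strict_deriv_uniform (y : R -> vec) (T : R) : {within `[0, T], continuous y} ->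
  forall e : R, 0 < e -> exists2 d, 0 < d & forall s x1 x2, 0 <= s <= T ->
    `|x1 - y s| < d -> `|x2 - y s| < d ->
    `|f s x1 - f s x2 - jac s (y s) *m (x1 - x2)| <= e * `|x1 - x2|.
Proof.
move=> cy e e0; have e'0 : 0 < e / n.+1%:R by rewrite divr_gt0.
have [d d0 Hd] := jac_uniform cy e'0; exists d => // s x1 x2 sT x1d x2d.
set J := jac s (y s); set w := x1 - x2.
have s0 : 0 <= s by case/andP: sT.
pose z (u : R) : vec := f s (x2 + u *: w) - u *: (J *m w).
have := @mean_value_closed R n (fun x => `|x|) z
  (fun u => jac s (x2 + u *: w) *m w - J *m w)
  (fun u => u * (e * `|w|)) (fun=> e * `|w|) 0 1 is_norm_mx_norm ler01.
have -> : z 1 - z 0 = f s x1 - f s x2 - J *m w.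
  rewrite /z !scale0r !scale1r subr0 addr0 /w subrKC.
  by rewrite addrAC.
rewrite mul1r mul0r subr0; apply.
- move=> u u01; have H := @is_derive_line s x2 w u s0.
  have H' : is_derive u 1 (fun u : R => u *: (J *m w)) (J *m w).
    apply/is_derive_epsdelta => e1 e10; exists 1 => // h _.
    rewrite scalerDl (addrC (u *: _)) addrK subrr normr0.
    by rewrite mulr_ge0// ltW.
  rewrite (_ : z = (fun u => f s (x2 + u *: w)) - (fun u => u *: (J *m w)))//.
  exact: (@is_deriveB _ _ _ _ _ _ _ _ _ H H').
- move=> u u01; apply/is_derive_epsdelta => e1 e10; exists 1 => // h _.
  rewrite /GRing.scale/= mulrDl (addrC (u * _)) addrK subrr normr0.
  by rewrite mulr_ge0// ltW.
- move=> u /andP[u0 u1]; rewrite -mulmxBl (le_trans (mulmx_norm_le _ _))//.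
  rewrite ler_wpM2r//.
  have : `|jac s (x2 + u *: w) - J| <= e / n.+1%:R.
    apply: Hd => //.
    have -> : x2 + u *: w - y s = u *: (x1 - y s) + (1 - u) *: (x2 - y s).
      by rewrite /w; apply/colP => i; rewrite !mxE; ring.
    rewrite (le_lt_trans (ler_normD _ _))// !normrZ ger0_norm//.
    rewrite ger0_norm ?subr_ge0//.
    move: x1d x2d; set a1 := `|_|; set a2 := `|_| => a1d a2d.
    have [->|u0'] := eqVneq u 0; first by rewrite mul0r add0r subr0 mul1r.
    have {u0'}up : 0 < u by rewrite lt_neqAle eq_sym u0'.
    have B1 : u * a1 < u * d by rewrite ltr_pM2l.
    have B2 : (1 - u) * a2 <= (1 - u) * d by rewrite ler_wpM2l ?subr_ge0// ltW.
    by move: B1 B2; set b1 := u * a1; set b2 := (1 - u) * a2; lra.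
  move=> /(ler_wpM2l (ler0n R n))/le_trans; apply.
  by rewrite mulrCA ler_piMr ?(ltW e0)// ler_pdivrMr// mul1r ler_nat.
Qed.

End OnePoint.

Variables (A : R -> mat) (f : R -> vec -> vec) (ysol : R -> R -> vec -> vec).
Hypothesis cA : {within `[0%R, +oo[, continuous A}.
Hypothesis solP : forall t eta, 0 <= t ->
  is_solution A f (fun s => ysol s t eta) /\ ysol t t eta = eta.
Variable Lc : R.
Hypothesis Lc0 : 0 <= Lc.
Hypothesis lipf : forall t y1 y2, 0 <= t -> `|f t y1 - f t y2| <= Lc * `|y1 - y2|.

Lemma flow_continuous t eta T : 0 <= t ->
  {within `[0, T], continuous (fun s => ysol s t eta)}.
Proof.
by move=> t0; have [[+ _] _] := @solP t eta t0; exact: continuous_half_line_segment.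
Qed.

Lemma linear_part_bound T : exists2 C, 0 <= C &
  forall s (w : vec), 0 <= s <= T -> `|A s *m w| <= C * `|w|.
Proof.
have [C C0 HC] := segment_bounded_norm (@continuous_half_line_segment _ _ T cA).
exists (n%:R * C); first by rewrite mulr_ge0.
move=> s w sT; rewrite (le_trans (mulmx_norm_le _ _))// ler_wpM2r//.
by rewrite ler_wpM2l// HC.
Qed.

(** [s] and [t] may come in either order, because the part of the integral before [t] follows the
    flow backward. *)
Lemma flow_lipschitz (T : R) : exists2 C, 0 < C &
  forall s t eta1 eta2, 0 <= s <= T -> 0 <= t <= T ->
  `|ysol s t eta1 - ysol s t eta2| <= C * `|eta1 - eta2|.
Proof.
have [C C0 HC] := linear_part_bound T.
exists (@gronwall_cst _ n (C + Lc) T).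
  by rewrite mulr_gt0// expR_gt0.
move=> s t eta1 eta2 sT tT; have t0 : 0 <= t by case/andP: tT.
pose w r := ysol r t eta1 - ysol r t eta2.
pose dw r := (A r *m ysol r t eta1 + f r (ysol r t eta1)) -
  (A r *m ysol r t eta2 + f r (ysol r t eta2)).
have [[_ d1] i1] := @solP t eta1 t0; have [[_ d2] i2] := @solP t eta2 t0.
have := @gronwall _ n w dw (C + Lc) 0 T (addr_ge0 C0 Lc0) (lexx 0).
have -> : `|eta1 - eta2| = `|w t| + 0 by rewrite addr0 /w i1 i2.
apply=> //.
- move=> r; apply: continuousB.
    exact: (@flow_continuous t eta1 T t0).
  exact: (@flow_continuous t eta2 T t0).
- move=> r /andP[r0 rT]; have H1 := d1 r r0; have H2 := d2 r r0.
  exact: is_deriveB.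
- move=> r /andP[/ltW r0 /ltW rT]; rewrite addr0 /dw opprD addrACA -mulmxBr.
  rewrite (le_trans (ler_normD _ _))// mulrDl lerD ?HC ?r0// lipf//.
Qed.

End Flow.

(** * Difference quotients of the flow in the initial value *)

Section FlowQuotient.
Set Implicit Arguments. Unset Strict Implicit. Unset Printing Implicit Defensive.
Context {R : realType} {n : nat}.
Local Notation vec := 'cV[R]_n.
Local Notation mat := 'M[R]_n.

Lemma within_continuous_sub (V W : normedModType R) (E : set V) (g1 g2 : V -> W) :
  {within E, continuous g1} -> {within E, continuous g2} ->
  {within E, continuous (fun s => g1 s - g2 s)}.
Proof.
move=> /within_continuous_epsdelta c1 /within_continuous_epsdelta c2.
apply/within_continuous_epsdelta => x Ex e e0.
have e20 : 0 < e / 2 by rewrite divr_gt0.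
have [d1 d10 H1] := c1 x Ex _ e20; have [d2 d20 H2] := c2 x Ex _ e20.
exists (Num.min d1 d2); first by rewrite lt_min d10.
move=> y Ey; rewrite lt_min => /andP[y1 y2].
rewrite opprD addrACA -opprD (le_lt_trans (ler_normB _ _))// (splitr e).
by rewrite ltrD ?H1 ?H2.
Qed.

Lemma within_continuous_scale (V W : normedModType R) (E : set V) (c : R)
    (g : V -> W) :
  {within E, continuous g} -> {within E, continuous (fun s => c *: g s)}.
Proof.
move=> /within_continuous_epsdelta cg; apply/within_continuous_epsdelta.
move=> x xE e e0; have k0 : 0 < `|c| + 1 by rewrite ltr_wpDl.
have [d d0 Hd] := cg x xE _ (divr_gt0 e0 k0); exists d => // y yE yx.
have := Hd y yE yx; rewrite ltr_pdivlMr// => H.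
by rewrite -scalerBr normrZ (le_lt_trans _ H)// mulrC ler_wpM2l// lerDl.
Qed.

Variables (A : R -> mat) (f : R -> vec -> vec) (ysol : R -> R -> vec -> vec).
Hypothesis cA : {within `[0%R, +oo[, continuous A}.
Hypothesis solP : forall t eta, 0 <= t ->
  is_solution A f (fun s => ysol s t eta) /\ ysol t t eta = eta.
Variable Lc : R.
Hypothesis Lc0 : 0 <= Lc.
Hypothesis lipf : forall t y1 y2, 0 <= t -> `|f t y1 - f t y2| <= Lc * `|y1 - y2|.

Hypothesis df : forall t x, 0 <= t -> differentiable (f t) x.
Hypothesis cdf : forall v : vec, {within [set p : R * vec | 0 <= p.1],
  continuous (fun p => d2 f p.1 p.2 v)}.

Local Notation flow_quot t v x h := (fun s => dquot (ysol s t) v x h).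

Lemma flow_quot_continuous (t : R) v x (h T : R) : 0 <= t ->
  {within `[0, T], continuous (flow_quot t v x h)}.
Proof.
move=> t0; apply: within_continuous_scale; apply: within_continuous_sub;
  exact: (flow_continuous solP).
Qed.

Lemma flow_quot_derive (t : R) (v x : vec) (h s : R) : 0 <= t -> 0 < s ->
  is_derive s 1 (flow_quot t v x h)
    (A s *m dquot (ysol s t) v x h + dquot (f s \o ysol s t) v x h).
Proof.
move=> t0 s0; have [[_ d1] _] := @solP t (x + h *: v) t0.
have [[_ d2] _] := @solP t x t0.
have := @is_deriveZ _ _ _ _ h^-1 _ _ _
  (@is_deriveB _ _ _ _ _ _ _ _ _ (d1 s s0) (d2 s s0)).
congr (is_derive _ _ _ _); rewrite /dquot/=.
rewrite opprD addrACA -mulmxBr scalerDr -scalemxAr//.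
Qed.

(* The difference of two difference quotients of the flow solves the linearised
   equation up to a small forcing term and vanishes at [t], so Gronwall makes the
   quotients Cauchy; the variational equation need not be solved. *)
Lemma field_quot_cauchy (t T : R) (eta v : vec) : 0 <= t <= T ->
  forall e : R, 0 < e -> exists2 d, 0 < d & forall x1 x2 h k,
    `|x1 - eta| < d -> `|x2 - eta| < d -> h != 0 -> k != 0 ->
    `|h| < d -> `|k| < d -> forall s, 0 <= s <= T ->
    `|dquot (f s \o ysol s t) v x1 h - dquot (f s \o ysol s t) v x2 k| <= e.
Proof.
move=> tT e e0; have /andP[t0 _] := tT.
have [CA CA0 HA] := linear_part_bound cA T.
have [C C0 HC] := flow_lipschitz cA solP Lc0 lipf T.
pose y s := ysol s t eta.
have cy : {within `[0, T], continuous y} by exact: (flow_continuous solP).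
pose J s := jac f s (y s).
have cJ : {within `[0, T], continuous J}.
  apply/within_continuous_epsdelta => s sT e1 e10.
  move: (sT); rewrite /= in_itv/= => /andP[s0 _].
  have /within_continuous_epsdelta/(_ (s, y s) s0 _ e10)[d d0 Hd] :=
    jac_continuous cdf.
  move/within_continuous_epsdelta : cy => /(_ s sT _ d0)[d' d'0 Hd'].
  exists (Num.min d d'); first by rewrite lt_min d0.
  move=> r rT; rewrite lt_min => /andP[rd rd'].
  apply: (Hd (r, y r)); first by move: rT; rewrite /= in_itv/= => /andP[].
  by rewrite /Num.Def.normr/= gt_max rd Hd'.
have [CJ0 CJ00 HJ0] := segment_bounded_norm cJ.
have [CJ [CJ_ge0 HJ]] : exists CJ : R, 0 <= CJ /\
    forall s (w : vec), 0 <= s <= T -> `|J s *m w| <= CJ * `|w|.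
  exists (n%:R * CJ0); split; first by rewrite mulr_ge0.
  move=> s w sT; rewrite (le_trans (mulmx_norm_le _ _))// ler_wpM2r//.
  by rewrite ler_wpM2l// HJ0.
have [G [G0 HG]] : exists G : R, 0 <= G /\ G = @gronwall_cst _ n (CA + CJ) T.
  by exists (@gronwall_cst _ n (CA + CJ) T); rewrite mulr_ge0// expR_ge0.
have Z0 : 0 < (CJ * G + 1) * (2 * (C * `|v| + 1)).
  by rewrite mulr_gt0 ?mulr_gt0// ltr_wpDl ?mulr_ge0// ltW.
(* [e'] is the precision of the linearisation of [f]. The resulting forcing [e' * (2 * (C * |v|))]
   enters the final bound once directly and once through [J] and the Gronwall factor [G]. *)
have [e' [e'0 e'E]] : exists e' : R,
    0 < e' /\ e' * ((CJ * G + 1) * (2 * (C * `|v| + 1))) = e.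
  exists (e / ((CJ * G + 1) * (2 * (C * `|v| + 1)))).
  by rewrite divr_gt0// divfK// gt_eqF.
have [d1 d10 Hd1] := strict_deriv_uniform df cdf cy e'0.
have v10 : 0 < `|v| + 1 by rewrite ltr_wpDl.
have Cv0 : 0 < C * (`|v| + 1) by rewrite mulr_gt0.
have [d [d0 dE]] : exists d : R, 0 < d /\ d * (C * (`|v| + 1)) = d1.
  by exists (d1 / (C * (`|v| + 1))); rewrite divr_gt0// divfK// gt_eqF.
exists d => //.
(* The remainder is relative to the increment of the flow, which is at most [C * |h| * |v|];
   dividing by [h] leaves a bound free of [h]. *)
have key x h s : `|x - eta| < d -> h != 0 -> `|h| < d -> 0 <= s <= T ->
    `|dquot (f s \o ysol s t) v x h - J s *m dquot (ysol s t) v x h| <=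
    e' * (C * `|v|).
  move=> xd h0 hd sT.
  have yx : `|ysol s t x - y s| < d1.
    rewrite (le_lt_trans (HC s t x eta sT tT))// -dE mulrCA ltr_pM2l//.
    by rewrite (lt_le_trans xd)// ler_peMr ?(ltW d0)// lerDr.
  have yxh : `|ysol s t (x + h *: v) - y s| < d1.
    rewrite (le_lt_trans (HC s t _ eta sT tT))// -dE mulrCA ltr_pM2l//.
    rewrite addrAC (le_lt_trans (ler_normD _ _))// normrZ mulrDr mulr1.
    by rewrite [ltRHS]addrC ltr_leD// ler_wpM2r// ltW.
  have H := Hd1 s _ _ sT yxh yx.
  rewrite /dquot/= -scalemxAr -scalerBr normrZ normfV mulrC.
  rewrite ler_pdivrMr ?normr_gt0// (le_trans H)// -mulrA ler_pM2l//.
  rewrite (le_trans (HC s t _ _ sT tT))// addrC addKr normrZ.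
  by rewrite -mulrA ler_pM2l// mulrC.
move=> x1 x2 h k x1d x2d h0 k0 hd kd s sT.
pose w r := dquot (ysol r t) v x1 h - dquot (ysol r t) v x2 k.
pose dw r := (A r *m dquot (ysol r t) v x1 h + dquot (f r \o ysol r t) v x1 h) -
  (A r *m dquot (ysol r t) v x2 k + dquot (f r \o ysol r t) v x2 k).
have key2 r : 0 <= r <= T ->
    `|(dquot (f r \o ysol r t) v x1 h - dquot (f r \o ysol r t) v x2 k) -
      J r *m w r| <= e' * (2 * (C * `|v|)).
  move=> rT; have H1 := key x1 h r x1d h0 hd rT; have H2 := key x2 k r x2d k0 kd rT.
  move: H1 H2; rewrite /w mulmxBr.
  move: (dquot _ _ _ _) (J r *m _) (dquot _ _ _ _) (J r *m _) => a3 a4 a1 a2 H1 H2.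
  have -> : a1 - a3 - (a2 - a4) = (a1 - a2) - (a3 - a4).
    by apply/colP => i; rewrite !mxE; ring.
  rewrite (le_trans (ler_normB _ _))//.
  by move: H1 H2; set b1 := `|_|; set b2 := `|_|; lra.
have quot_t x' h' : h' != 0 -> dquot (ysol t t) v x' h' = v.
  move=> h'0; rewrite /dquot (@solP t _ t0).2 (@solP t x' t0).2 addrC addKr.
  by rewrite scalerA mulVf// scale1r.
have k00 : 0 <= e' * (2 * (C * `|v|)) by rewrite !mulr_ge0// ltW.
have ws : `|w s| <= G * (e' * (2 * (C * `|v|))).
  have := @gronwall _ n w dw (CA + CJ) _ T (addr_ge0 CA0 CJ_ge0) k00.
  rewrite -HG => /(_ _ _ _ s t sT tT).
  have -> : w t = 0 by rewrite /w !quot_t// subrr.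
  rewrite normr0 add0r; apply.
  - by apply: within_continuous_sub; exact: flow_quot_continuous.
  - move=> r /andP[r0 rT].
    have H1 := @flow_quot_derive t v x1 h r t0 r0.
    have H2 := @flow_quot_derive t v x2 k r t0 r0.
    exact: (@is_deriveB _ _ _ _ _ _ _ _ _ H1 H2).
  - move=> r /andP[/ltW r0 /ltW rT]; have rT' : 0 <= r <= T by rewrite r0.
    have H1 := key2 r rT'; have H2 := HJ r (w r) rT'; have H3 := HA r (w r) rT'.
    have -> : dw r = A r *m w r + (J r *m w r +
        ((dquot (f r \o ysol r t) v x1 h - dquot (f r \o ysol r t) v x2 k) -
          J r *m w r)).
      by rewrite subrKC /dw /w mulmxBr opprD addrACA.
    rewrite (le_trans (ler_normD _ _))// mulrDl -[leRHS]addrA lerD//.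
    by rewrite (le_trans (ler_normD _ _))// lerD.
have := key2 s sT; set u := dquot _ _ _ _ - dquot _ _ _ _ => H.
rewrite -(subrK (J s *m w s) u) (le_trans (ler_normD _ _))//.
rewrite (le_trans (lerD H (HJ s _ sT)))//.
rewrite (le_trans (lerD (lexx _) (ler_wpM2l CJ_ge0 ws)))//.
have -> : e' * (2 * (C * `|v|)) + CJ * (G * (e' * (2 * (C * `|v|)))) =
   e' * ((CJ * G + 1) * (2 * (C * `|v|))) by ring.
rewrite -e'E ler_pM2l// ler_wpM2l ?addr_ge0 ?mulr_ge0//.
by rewrite ler_wpM2l// lerDl.
Qed.

End FlowQuotient.

(** * The evolution operator as a function of both of its times *)

Section Evolution.
Set Implicit Arguments. Unset Strict Implicit. Unset Printing Implicit Defensive.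
Context {R : realType} {n : nat}.
Local Notation vec := 'cV[R]_n.
Local Notation mat := 'M[R]_n.

Lemma mulmx_ext (M M' : mat) : (forall v : vec, M *m v = M' *m v) -> M = M'.
Proof.
move=> H; apply/matrixP => i j; have := H (delta_mx j ord0).
by rewrite -!colE => /colP/(_ i); rewrite !mxE.
Qed.

Lemma mx_norm_le_mulmx (M : mat) (C : R) : 0 <= C ->
  (forall v : vec, `|M *m v| <= C * `|v|) -> `|M| <= C.
Proof.
move=> C0 H; apply: mx_norm_le => // i j.
have := mx_entry_le_norm (M *m (delta_mx j ord0 : vec)) i ord0.
rewrite -colE mxE => /le_trans; apply; rewrite colE (le_trans (H _))//.
rewrite ler_piMr//; apply: mx_norm_le => // k l; rewrite mxE.
by case: (_ && _); rewrite ?normr0 ?normr1.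
Qed.

Variables (A : R -> mat) (Phi : R -> R -> mat).
Hypothesis cA : {within `[0%R, +oo[, continuous A}.
Hypothesis PhiP : is_evolution_operator A Phi.

Lemma linear_uniq (w : R -> vec) (t T : R) : 0 <= t <= T ->
  {within `[0, T], continuous w} ->
  (forall r, 0 < r < T -> is_derive r 1 w (A r *m w r)) ->
  w t = 0 -> forall s, 0 <= s <= T -> w s = 0.
Proof.
move=> tT cw Hw wt s sT; have [C C0 HC] := linear_part_bound cA T.
have Hb r : 0 < r < T -> `|A r *m w r| <= C * `|w r| + 0.
  by move=> /andP[/ltW r0 /ltW rT]; rewrite addr0 HC// r0.
have := @gronwall _ n w _ C 0 T C0 (lexx 0) cw Hw Hb s t sT tT.
by rewrite wt normr0 addr0 mulr0 normr_le0 => /eqP.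
Qed.

Lemma evolution_vec_continuous (s T : R) (v : vec) : 0 <= s ->
  {within `[0, T], continuous (fun t => Phi t s *m v)}.
Proof.
move=> s0; have [_ cP _] := PhiP s0.
apply: within_continuous_mulmx; first exact: continuous_half_line_segment.
exact: continuous_subspaceT (@cst_continuous _ _ v).
Qed.

Lemma evolution_vec_derive (s t : R) (v : vec) : 0 <= s -> 0 < t ->
  is_derive t 1 (fun t => Phi t s *m v) (A t *m (Phi t s *m v)).
Proof.
move=> s0 t0; have [_ _ /(_ t t0) dP] := PhiP s0.
have := is_derive_mulmx dP (is_derive_cst v t 1).
by rewrite mulmx0 addr0 mulmxA.
Qed.

Lemma evolution_bound (T : R) : exists2 G, 0 < G &
  forall s r, 0 <= s <= T -> 0 <= r <= T -> `|Phi s r| <= G.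
Proof.
have [C C0 HC] := linear_part_bound cA T.
exists (@gronwall_cst _ n C T); first by rewrite mulr_gt0// expR_gt0.
move=> s r sT rT; have r0 : 0 <= r by case/andP: rT.
apply: mx_norm_le_mulmx => [|v]; first by rewrite mulr_ge0// expR_ge0.
have := @gronwall _ n (fun t => Phi t r *m v) (fun t => A t *m (Phi t r *m v)) C 0 T
  C0 (lexx 0) (@evolution_vec_continuous r T v r0).
move=> /(_ _ _ s r sT rT); have [-> _ _] := PhiP r0; rewrite mul1mx addr0; apply.
- by move=> u /andP[u0 _]; exact: evolution_vec_derive.
- by move=> u /andP[/ltW u0 /ltW uT]; rewrite addr0 HC// u0.
Qed.

(** Applied to a vector, both sides solve the linear equation in [t] and agree at [t = s]. *)
Lemma evolution_cocycle (t s r : R) : 0 <= t -> 0 <= s -> 0 <= r ->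
  Phi t s *m Phi s r = Phi t r.
Proof.
move=> t0 s0 r0; apply: mulmx_ext => v; rewrite -mulmxA.
apply: subr0_eq; pose T := Num.max t s.
have := @linear_uniq (fun u => Phi u s *m (Phi s r *m v) - Phi u r *m v) s T.
have sT : 0 <= s <= T by rewrite s0 le_max lexx orbT.
have tT : 0 <= t <= T by rewrite t0 le_max lexx.
move=> /(_ sT) H; apply: H => //.
- by apply: within_continuous_sub; exact: evolution_vec_continuous.
- move=> u /andP[u0 _]; rewrite mulmxBr.
  have H1 := @evolution_vec_derive s u (Phi s r *m v) s0 u0.
  have H2 := @evolution_vec_derive r u v r0 u0.
  exact: (@is_deriveB _ _ _ _ _ _ _ _ _ H1 H2).
- by have [-> _ _] := PhiP s0; rewrite mul1mx subrr.
Qed.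

(** The definition gives regularity in the first time only. The cocycle identity turns a change of
    the second time into one of the first: [Phi t r - Phi t s = Phi t r *m (Phi s s - Phi r s)]. *)
Lemma evolution_continuous2 (t : R) : 0 <= t ->
  {within `[0%R, +oo[, continuous (fun s => Phi t s)}.
Proof.
move=> t0; apply/within_continuous_epsdelta => s sE e e0.
have s0 : 0 <= s by move: sE; rewrite /= in_itv/= andbT.
pose T := Num.max t (s + 1).
have [G G0 HG] := evolution_bound T.
have tT : 0 <= t <= T by rewrite t0 le_max lexx.
have n1 : 0 < n.+1%:R * G by rewrite mulr_gt0.
have [Ps /within_continuous_epsdelta/(_ s sE _ (divr_gt0 e0 n1))[d d0 Hd] _] :=
  PhiP s0.
exists (Num.min d 1); first by rewrite lt_min d0 ltr01.
move=> r rE; rewrite lt_min => /andP[rd r1].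
have r0 : 0 <= r by move: rE; rewrite /= in_itv/= andbT.
have rT : 0 <= r <= T.
  by rewrite r0 le_max; apply/orP; right; move/ltr_normlP: r1 => []; lra.
have -> : Phi t r - Phi t s = Phi t r *m (Phi s s - Phi r s).
  by rewrite Ps mulmxBr mulmx1 evolution_cocycle.
have := Hd r rE rd; rewrite distrC ltr_pdivlMr// => H.
rewrite (le_lt_trans (mulmx_norm_le _ _))// (le_lt_trans _ H)// mulrC.
rewrite ler_wpM2l// ler_pM// ?HG// ler_nat//.
Qed.

(** The adjoint equation: in variation of constants it cancels the linear part of the derivative of
    [Phi x r *m D r]. *)
Lemma evolution_derive2 (t r : R) : 0 <= t -> 0 < r ->
  is_derive r 1 (fun s => Phi t s) (- (Phi t r *m A r)).
Proof.
move=> t0 r0; apply/is_derive_epsdelta => e e0.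
pose T := Num.max t (r + 1).
have [G G0 HG] := evolution_bound T.
have e20 : 0 < e / 2 by rewrite divr_gt0.
have nG0 : 0 < n.+1%:R * G by rewrite mulr_gt0.
have nA0 : 0 < n.+1%:R * (`|A r| + 1) by rewrite mulr_gt0// ltr_wpDl.
have [Prr _ /(_ r r0)] := PhiP (ltW r0).
move=> /is_derive_epsdelta/(_ _ (divr_gt0 e20 nG0))[d1 d10 Hd1].
have rE : `[0%R, +oo[%classic r by rewrite /= in_itv/= andbT ltW.
have /within_continuous_epsdelta := evolution_continuous2 t0.
move=> /(_ r rE _ (divr_gt0 e20 nA0))[d2 d20 Hd2].
exists (Num.min (Num.min d1 d2) (Num.min r 1)).
  by rewrite !lt_min d10 d20 r0 ltr01.
move=> h; rewrite !lt_min => /andP[/andP[hd1 hd2] /andP[hr h1]].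
have /ltr_normlP[hr1 hr2] := hr; have /ltr_normlP[h11 h12] := h1.
have rh0 : 0 <= r + h by lra.
have rhT : 0 <= r + h <= T.
  by rewrite rh0 le_max; apply/orP; right; lra.
have tT : 0 <= t <= T by rewrite t0 le_max lexx.
(* The cocycle identity reduces the increment to [Phi (r + h) r - Phi r r]; the last term corrects
   for [Phi t (r + h)] in place of [Phi t r] and is small by continuity. *)
have -> : Phi t (r + h) - Phi t r - h *: - (Phi t r *m A r) =
   - (Phi t (r + h) *m (Phi (r + h) r - Phi r r - h *: (A r *m Phi r r))) -
   h *: ((Phi t (r + h) - Phi t r) *m A r).
  rewrite Prr mulmx1 !mulmxBr mulmxBl mulmx1 -scalemxAr.
  rewrite evolution_cocycle ?(ltW r0)//.
  move: (Phi t (r + h)) (Phi t r) (_ *m A r) (_ *m A r) => a b c k.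
  by apply/matrixP => i j; rewrite !mxE; ring.
rewrite (le_trans (ler_normB _ _))// normrN (splitr e) mulrDl lerD//.
  rewrite (le_trans (mulmx_norm_le _ _))//.
  have := Hd1 h hd1; rewrite mulrAC ler_pdivlMr// => /(le_trans _); apply.
  by rewrite mulrC ler_wpM2l// ler_pM// ?HG// ler_nat.
rewrite normrZ mulrC ler_wpM2r// (le_trans (mulmx_norm_le _ _))//.
have rhE : `[0%R, +oo[%classic (r + h) by rewrite /= in_itv/= rh0.
have rhr : `|r + h - r| < d2 by rewrite addrC addKr.
have := Hd2 _ rhE rhr; rewrite ltr_pdivlMr// => /ltW; apply: le_trans.
by rewrite (mulrC n%:R) -mulrA ler_wpM2l// ler_pM// ?ler_nat// lerDl.
Qed.

End Evolution.

(** * Sharp forward growth of the difference of two solutions *)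

Section SharpEstimate.
Set Implicit Arguments. Unset Strict Implicit. Unset Printing Implicit Defensive.
Context {R : realType} {n : nat}.
Local Notation vec := 'cV[R]_n.
Local Notation mat := 'M[R]_n.
Variables (N : vec -> R) (A : R -> mat) (f : R -> vec -> vec).
Variables (ysol : R -> R -> vec -> vec) (Phi : R -> R -> mat).
Variables (K0 a eps Lf theta : R).
Hypothesis hN : is_norm N.
Hypothesis cA : {within `[0%R, +oo[, continuous A}.
Hypothesis solP : forall t eta, 0 <= t ->
  is_solution A f (fun s => ysol s t eta) /\ ysol t t eta = eta.
Hypothesis PhiP : is_evolution_operator A Phi.
Hypothesis K0_ge0 : 0 <= K0.
Hypothesis growth : forall t s w, 0 <= t -> 0 <= s ->
  N (Phi t s *m w) <= K0 * expR (a * `|t - s| + eps * s) * N w.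
Hypothesis Lf_ge0 : 0 <= Lf.
Hypothesis lipN : forall t y1 y2, 0 <= t ->
  N (f t y1 - f t y2) <= Lf * expR (- theta * t) * N (y1 - y2).
Hypothesis eps_theta : eps < theta.

(* Gronwall through the variation of constants formula: the ratio of
   [N (y1 - y2)] and the expected bound attains a maximum [m] on [t, s]; the mean
   value inequality for [r |-> Phi x r *m (y1 r - y2 r)] at the maximiser [x]
   bounds [m]. *)
Lemma flow_growth (t s : R) (eta1 eta2 : vec) : 0 <= t -> t <= s ->
  N (ysol s t eta1 - ysol s t eta2) <=
  K0 * expR (Lf * K0 / (theta - eps)) * expR (a * (s - t) + eps * t) *
  N (eta1 - eta2).
Proof.
move=> t0 ts; have [N0 NI NZ ND] := hN; have s0 := le_trans t0 ts.
have te0 : 0 < theta - eps by rewrite subr_gt0.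
pose D r : vec := ysol r t eta1 - ysol r t eta2.
have [[c1 d1] i1] := @solP t eta1 t0; have [[c2 d2] i2] := @solP t eta2 t0.
have Dt : D t = eta1 - eta2 by rewrite /D i1 i2.
have [c0 [c00 c0E]] : exists c0 : R, 0 <= c0 /\ c0 = Lf * K0 / (theta - eps).
  by exists (Lf * K0 / (theta - eps)); rewrite divr_ge0 ?mulr_ge0 ?(ltW te0).
(* The primitive of [Lf * K0 * expR ((eps - theta) * r)] vanishing at [t]; since [eps < theta] it
   stays below [c0], the exponent of the final constant. *)
pose k (r : R) := c0 * (expR ((eps - theta) * t) - expR ((eps - theta) * r)).
have dk (r : R) : is_derive r 1 k (Lf * K0 * expR ((eps - theta) * r)).
  apply: is_derive_eq; rewrite /GRing.scale/= c0E; field.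
  by rewrite gt_eqF.
have cts_of (g : R -> R) (dg : R -> R) : (forall r : R, is_derive r 1 g (dg r)) ->
    continuous g.
  move=> H r; apply: differentiable_continuous; apply/derivable1_diffP.
  by case: (H r).
(* [V] is the reciprocal of the expected growth, so [rho] is the ratio to be maximised. *)
pose V (r : R) := expR (- (a * (r - t) + k r)).
have cV : continuous V.
  apply: (@cts_of V (fun r => - (a + Lf * K0 * expR ((eps - theta) * r)) * V r)).
  by move=> r; have := dk r => dkr; apply: is_derive_eq; rewrite /V /GRing.scale/=; ring.
have cD : {within `[0, s], continuous D}.
  by apply: within_continuous_sub; exact: (flow_continuous solP).
have ts_sub : `[t, s] `<=` `[0, s].
  by move=> r; rewrite /= !in_itv/= => /andP[/(le_trans t0) -> ->].
have cDt : {within `[t, s], continuous D} := continuous_subspaceW ts_sub cD.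
pose rho r := N (D r) * V r.
have crho : {within `[t, s], continuous rho}.
  have cND : {within `[t, s], continuous (fun r => N (D r))}.
    move/within_continuous_epsdelta : cDt => cDt.
    apply/within_continuous_epsdelta => r rE e e0.
    have cN : continuous N := is_norm_continuous hN.
    have /continuous_epsdelta/(_ _ e0)[d d0 Hd] := cN (D r).
    have [d' d'0 Hd'] := cDt r rE d d0; exists d' => // u uE ur.
    by apply: Hd; exact: Hd'.
  rewrite (_ : rho = (fun r => N (D r)) * V)// => r.
  by apply: continuousM; [exact: cND|exact: (continuous_subspaceT cV)].
have [x xts xmax] := EVT_max ts crho.
have [m mE] : exists m, m = rho x by exists (rho x).
have m0 : 0 <= m by rewrite mE mulr_ge0// expR_ge0.
move: (xts); rewrite in_itv/= => /andP[tx xs].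
have x0 := le_trans t0 tx.
have ND_le r : t <= r -> r <= s -> N (D r) <= m * expR (a * (r - t) + k r).
  move=> tr rs; have := xmax r; rewrite in_itv/= tr rs => /(_ isT).
  by rewrite -mE /rho /V expRN ler_pdivrMr ?expR_gt0.
have NDx : N (D x) = m * expR (a * (x - t) + k x).
  by rewrite mE /rho /V expRN divfK// gt_eqF// expR_gt0.
(* The growth [a * (x - r)] of [Phi x r] and [a * (r - t)] of [D r] add up to [a * (x - t)] for
   every [r]. This factor is therefore constant, and only [k] contributes to the derivative of
   [B]. *)
pose B r := m * expR (a * (x - t)) * expR (k r).
have dB (r : R) : is_derive r 1 B (Lf * K0 * expR ((eps - theta) * r) * B r).
  by have := dk r => dkr; apply: is_derive_eq; rewrite /B /GRing.scale/=; ring.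
have cB := cts_of _ _ dB.
pose df r := f r (ysol r t eta1) - f r (ysol r t eta2).
have dD (r : R) : 0 < r -> is_derive r 1 D (A r *m D r + df r).
  move=> r0; have H1 := d1 r r0; have H2 := d2 r r0.
  have := @is_deriveB _ _ _ _ _ _ _ _ _ H1 H2.
  by rewrite opprD addrACA -mulmxBr.
have dz (r : R) : 0 < r ->
    is_derive r 1 (fun r => Phi x r *m D r) (Phi x r *m df r).
  move=> r0; have := is_derive_mulmx (evolution_derive2 cA PhiP x0 r0) (dD r r0).
  by rewrite mulmxDr mulmxA mulNmx addKr.
have H : N (Phi x x *m D x - Phi x t *m D t) <= B x - B t.
  apply: (@mean_value_norm _ _ N (fun r => Phi x r *m D r)
    (fun r => Phi x r *m df r) B (fun r => Lf * K0 * expR ((eps - theta) * r) * B r)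
    t x hN tx).
  - have tx_sub : `[t, x] `<=` `[0, s].
      move=> r; rewrite /= !in_itv/= => /andP[/(le_trans t0) -> /le_trans].
      exact.
    apply: within_continuous_mulmx; last exact: continuous_subspaceW cD.
    have := evolution_continuous2 cA PhiP x0; apply: continuous_subspaceW.
    by move=> r; rewrite /= !in_itv/= => /andP[/(le_trans t0) ->].
  - exact: continuous_subspaceT cB.
  - by move=> r /andP[tr _]; apply: dz; exact: le_lt_trans tr.
  - move=> r /andP[tr rx]; have r0 := le_trans t0 (ltW tr).
    rewrite (le_trans (growth _ x0 r0))// ger0_norm ?subr_ge0 ?(ltW rx)//.
    have e1 := @lipN r (ysol r t eta1) (ysol r t eta2) r0.
    have e2 := ND_le r (ltW tr) (le_trans (ltW rx) xs).
    have e3 : N (df r) <= Lf * expR (- theta * r) * (m * expR (a * (r - t) + k r)).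
      by rewrite (le_trans e1)// ler_wpM2l// mulr_ge0// expR_ge0.
    have kx0 : 0 <= K0 * expR (a * (x - r) + eps * r).
      by rewrite mulr_ge0// expR_ge0.
    rewrite (le_trans (ler_wpM2l kx0 e3))// /B le_eqVlt; apply/orP; left; apply/eqP.
    rewrite [LHS](_ : _ = Lf * K0 * m * (expR (a * (x - r) + eps * r) *
      expR (- theta * r) * expR (a * (r - t) + k r))); last by ring.
    rewrite [RHS](_ : _ = Lf * K0 * m * (expR ((eps - theta) * r) *
      expR (a * (x - t)) * expR (k r))); last by ring.
    by rewrite -!expRD; congr (_ * expR _); ring.
have [Pxx _ _] := PhiP x0; move: H; rewrite Pxx mul1mx Dt => H.
have kt : k t = 0 by rewrite /k subrr mulr0.
have G := @growth x t (eta1 - eta2) x0 t0; rewrite ger0_norm ?subr_ge0// in G.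
(* As [x] is the maximiser, [B x = N (D x)]. It cancels on both sides, leaving
   [B t = m * expR (a * (x - t))] bounded by [N (Phi x t *m (eta1 - eta2))]. *)
have m_le : m <= K0 * expR (eps * t) * N (eta1 - eta2).
  have E0 : 0 < expR (a * (x - t)) by exact: expR_gt0.
  rewrite -(ler_pM2l E0).
  have T1 : N (D x) <= N (D x - Phi x t *m (eta1 - eta2)) + N (Phi x t *m (eta1 - eta2)).
    by have := ND (D x - Phi x t *m (eta1 - eta2)) (Phi x t *m (eta1 - eta2));
      rewrite subrK.
  have T2 : expR (a * (x - t)) * (K0 * expR (eps * t) * N (eta1 - eta2)) =
      K0 * expR (a * (x - t) + eps * t) * N (eta1 - eta2) by rewrite expRD; ring.
  rewrite T2; move: H T1 G NDx; rewrite /B kt expR0 mulr1 (expRD (a * (x - t)) (k x)).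
  rewrite (mulrA m) (mulrC _ m); move: (m * _) (m * _ * _) => u v.
  move: (N (D x)) (N (D x - _)) (N (Phi x t *m _)) (_ * N _) => ? ? ? ?; lra.
have := ND_le s ts (lexx s) => /le_trans; apply.
rewrite (le_trans (ler_wpM2r (expR_ge0 _) m_le))//.
have ks : k s <= c0.
  rewrite /k ler_piMr// lerBlDr (@le_trans _ _ 1)//.
    by rewrite -expR0 ler_expR mulr_le0_ge0// subr_le0 ltW.
  by rewrite lerDl expR_ge0.
rewrite -c0E [leLHS](_ : _ = K0 * expR (eps * t) * expR (a * (s - t)) * N (eta1 - eta2)
  * expR (k s)); last by rewrite expRD; ring.
rewrite [leRHS](_ : _ = K0 * expR (eps * t) * expR (a * (s - t)) * N (eta1 - eta2)
  * expR c0); last by rewrite expRD; ring.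
by rewrite ler_wpM2l ?ler_expR// !mulr_ge0// expR_ge0.
Qed.

End SharpEstimate.

(** * Exponential tails and integrals of vector-valued functions *)

Section VectorIntegral.
Set Implicit Arguments. Unset Strict Implicit. Unset Printing Implicit Defensive.
Context {R : realType} {n : nat}.
Local Notation vec := 'cV[R]_n.
Local Notation mu := (@lebesgue_measure R).

Lemma expR_linear_cvg0 (k : R) : 0 < k -> expR (- (k * x)) @[x --> +oo] --> (0 : R).
Proof.
move=> k0; apply: (@cvg_comp _ _ _ (fun x => k * x) (fun x : R => expR (- x))
  _ (+oo%R : set_system R)).
  by apply/cvgryPge => B; near=> x; rewrite -ler_pdivrMl//; near: x;
    exact: nbhs_pinfty_ge.
exact: cvgr_expR.
Unshelve. all: by end_near. Qed.

Lemma expR_linear_small (k d : R) : 0 < k -> 0 < d ->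
  exists T, forall s, T <= s -> expR (- (k * s)) <= d.
Proof.
move=> k0 d0; have /cvgrPdist_le/(_ _ d0)[T [_ HT]] := expR_linear_cvg0 k0.
exists (T + 1) => s Ts; have := HT s; rewrite sub0r normrN ger0_norm ?expR_ge0//.
by apply; rewrite (lt_le_trans _ Ts)// ltrDl.
Qed.

Lemma expR_linear_derive (k c x : R) :
  is_derive x 1 (fun x => c * expR (- (k * x))) (- (k * c) * expR (- (k * x))).
Proof. by apply: is_derive_eq; rewrite /GRing.scale/=; ring. Qed.

Lemma expR_linear_continuous (k c : R) : continuous (fun x => c * expR (- (k * x))).
Proof.
move=> x; apply: differentiable_continuous; apply/derivable1_diffP.
by case: (expR_linear_derive k c x).
Qed.

Lemma integral_expR_tail (k T : R) : 0 < k ->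
  (\int[mu]_(x in `[T, +oo[) (expR (- (k * x)))%:E = (expR (- (k * T)) / k)%:E)%E.
Proof.
move=> k0; pose F x := - k^-1 * expR (- (k * x)).
have FE : forall x : R, is_derive x 1 F (expR (- (k * x))).
  move=> x; have := expR_linear_derive k (- k^-1) x.
  by rewrite mulrN opprK divff ?mul1r// gt_eqF.
rewrite (@ge0_continuous_FTC2y _ (fun x => expR (- (k * x))) F T 0).
- by rewrite -EFinB /F sub0r mulNr opprK mulrC.
- by move=> x _; exact: expR_ge0.
- apply: continuous_subspaceT => x; have := @expR_linear_continuous k 1 x.
  by under eq_fun do rewrite mul1r.
- by rewrite /F -(mulr0 (- k^-1)); apply: cvgMr; exact: expR_linear_cvg0.
- by move=> x _; case: (FE x).
- apply: cvg_at_right_filter; exact: expR_linear_continuous.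
- by move=> x _; rewrite derive1E; case: (FE x).
Qed.

Lemma integrable_expR_tail (k c T : R) : 0 < k ->
  mu.-integrable `[T, +oo[ (EFin \o (fun x => c * expR (- (k * x)))).
Proof.
move=> k0; suff : mu.-integrable `[T, +oo[ (EFin \o (fun x => expR (- (k * x)))).
  by move=> H; exact: (@integrableZl _ _ _ mu _ _ c _ H).
apply/integrableP; split.
  have ce : continuous (fun x : R => expR (- (k * x))).
    move=> x; have := @expR_linear_continuous k 1 x.
    by under eq_fun do rewrite mul1r.
  have me := continuous_measurable_fun ce.
  exact/measurable_EFinP/measurable_funTS.
under eq_integral do rewrite gee0_abs ?lee_fin ?expR_ge0//.
by rewrite integral_expR_tail// ltry.
Qed.

Lemma Rintegral_expR_tail (k c T : R) : 0 < k ->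
  \int[mu]_(x in `[T, +oo[) (c * expR (- (k * x))) = c * (expR (- (k * T)) / k).
Proof.
move=> k0; rewrite RintegralZl//=.
  by rewrite /Rintegral integral_expR_tail.
have := @integrable_expR_tail k 1 T k0; apply: eq_integrable => //= x _.
by rewrite mul1r.
Qed.

Implicit Types (S : set (measurableTypeR R)) (H : R -> vec) (b : R -> R).

(** On [[0, +oo[] this is [integral0oo]; other domains serve to cut the integral. *)
Definition vintegral (S : set (measurableTypeR R)) (H : R -> vec) : vec :=
  \col_i (\int[mu]_(s in S) H s i ord0).

Definition vintegrable (S : set (measurableTypeR R)) (H : R -> vec) :=
  forall i, mu.-integrable S (EFin \o (fun s => H s i ord0)).

Lemma vintegrableB S (H1 H2 : R -> vec) : measurable S -> vintegrable S H1 ->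
  vintegrable S H2 -> vintegrable S (fun s => H1 s - H2 s).
Proof.
move=> mS i1 i2 i; have := integrableB mS (i1 i) (i2 i).
by apply: eq_integrable => // s _ /=; rewrite !mxE.
Qed.

Lemma vintegrableZ S (c : R) H : measurable S -> vintegrable S H ->
  vintegrable S (fun s => c *: H s).
Proof.
move=> mS i1 i; have := integrableZl mS c (i1 i).
by apply: eq_integrable => // s _ /=; rewrite !mxE.
Qed.

Lemma vintegralB S (H1 H2 : R -> vec) : measurable S -> vintegrable S H1 ->
  vintegrable S H2 ->
  vintegral S (fun s => H1 s - H2 s) = vintegral S H1 - vintegral S H2.
Proof.
move=> mS i1 i2; apply/colP => i; rewrite !mxE -RintegralB//.
by apply: eq_Rintegral => s _; rewrite !mxE.
Qed.

Lemma vintegralZ S (c : R) H : measurable S -> vintegrable S H ->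
  vintegral S (fun s => c *: H s) = c *: vintegral S H.
Proof.
move=> mS i1; apply/colP => i; rewrite !mxE -RintegralZl//.
by apply: eq_Rintegral => s _; rewrite !mxE.
Qed.

Lemma eq_vintegral S (H1 H2 : R -> vec) : (forall s : R, S s -> H1 s = H2 s) ->
  vintegral S H1 = vintegral S H2.
Proof.
move=> E; apply/colP => i; rewrite !mxE; apply: eq_Rintegral => s.
by rewrite inE => /E ->.
Qed.

Lemma vintegral_split (a b : itv_bound R) (x : R) H :
  vintegrable [set` Interval a b] H -> (a <= BRight x)%O -> (BRight x <= b)%O ->
  vintegral [set` Interval a b] H = vintegral [set` Interval a (BRight x)] H +
    vintegral [set` Interval (BRight x) b] H.
Proof.
move=> iH ax xb; apply/colP => i; rewrite !mxE.
by rewrite -(Rintegral_itvB (iH i) ax xb) subrKC.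
Qed.

(** The maximum norm is read off entry by entry, so the scalar bound suffices; this serves estimates
    whose constants do not matter. *)
Lemma vintegral_norm_le S H b : measurable S -> vintegrable S H ->
  mu.-integrable S (EFin \o b) -> (forall s : R, S s -> `|H s| <= b s) ->
  `|vintegral S H| <= \int[mu]_(s in S) b s.
Proof.
move=> mS iH ib Hb; apply: mx_norm_le.
  by apply: Rintegral_ge0 => s /Hb; exact: le_trans.
move=> i j; rewrite mxE (le_trans (le_normr_Rintegral mS (iH i)))//.
apply: le_Rintegral => //.
  by have := integrable_norm (iH i); exact: eq_integrable.
by move=> s Ss; rewrite (le_trans _ (Hb s Ss))// mx_entry_le_norm.
Qed.

Lemma vintegrable_le S H b : measurable S ->
  (forall i, measurable_fun S (fun s : measurableTypeR R => H s i ord0)) ->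
  mu.-integrable S (EFin \o b) -> (forall s : R, S s -> `|H s| <= b s) ->
  vintegrable S H.
Proof.
move=> mS mH ib Hb i; apply: (le_integrable mS _ _ ib).
  exact/measurable_EFinP.
move=> s Ss /=; rewrite lee_fin (le_trans _ (ler_norm _))//.
by rewrite (le_trans _ (Hb s Ss))// mx_entry_le_norm.
Qed.

(* The primitive of [H] obeys the mean value inequality for the arbitrary norm
   [N], which replaces the triangle inequality for [N] of an integral. *)
Lemma vintegral_segment_norm (N : vec -> R) (H : R -> vec) (B dB : R -> R) (p q : R) :
  is_norm N -> p <= q -> {within `[p, q], continuous H} ->
  (forall s : R, is_derive s 1 B (dB s)) ->
  (forall s, p < s < q -> N (H s) <= dB s) ->
  N (vintegral `[p, q] H) <= B q - B p.
Proof.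
move=> hN pq cH HB Hb.
have cHi i : {within `[p, q], continuous (fun s => H s i ord0)}.
  exact: (@within_continuous_coord _ _ _ _ _ _ i ord0 cH).
have iH i : mu.-integrable `[p, q] (EFin \o (fun s => H s i ord0)).
  by apply: continuous_compact_integrable => //; exact: segment_compact.
pose J r := vintegral `[p, r] H.
have Jp : J p = 0.
  by apply/colP => i; rewrite !mxE set_itv1 Rintegral_set1.
rewrite -[vintegral _ _]/(J q) -(subr0 (J q)) -Jp.
apply: (@mean_value_norm _ _ N J H B dB p q hN pq).
- apply: within_continuous_mx => i j.
  have -> : (fun x => J x i j) =
      (parameterized_integral mu p)^~ (fun s => H s i ord0).
    by apply/funext => r; rewrite mxE.
  exact: (parameterized_integral_continuous pq (iH i)).
- apply: continuous_subspaceT => s; apply: differentiable_continuous.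
  by apply/derivable1_diffP; case: (HB s).
- move=> s /andP[ps sq]; apply/is_derive_mx => i j; rewrite (ord1 j).
  have cs : {for s, continuous (fun s => H s i ord0)}.
    apply/continuous_epsdelta => e e0.
    have sE : `[p, q]%classic s by rewrite /= in_itv/= !ltW.
    have /within_continuous_epsdelta/(_ s sE e e0)[d d0 Hd] := cHi i.
    exists (Num.min d (Num.min (s - p) (q - s))).
      by rewrite !lt_min d0 !subr_gt0 ps.
    move=> y; rewrite !lt_min => /andP[yd /andP[y1 y2]]; apply: Hd => //.
    move/ltr_normlP: y1 => [y1 y1']; move/ltr_normlP: y2 => [y2 y2'].
    by rewrite /= in_itv/=; apply/andP; split; lra.
  have [d1 d2] := continuous_FTC1_closed sq (iH i) ps cs.
  have E : (fun y => J y i 0) = (fun x0 => \int[mu]_(t in `[p, x0]) H t i ord0).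
    by apply/funext => r; rewrite mxE.
  rewrite E; apply: DeriveDef; first exact: d1.
  by rewrite -derive1E; exact: d2.
- exact: Hb.
Qed.

End VectorIntegral.

(** * The integral term of the conjugacy *)

Section Conjugacy.
Set Implicit Arguments. Unset Strict Implicit. Unset Printing Implicit Defensive.
Context {R : realType} {n : nat}.
Local Notation vec := 'cV[R]_n.
Local Notation mat := 'M[R]_n.
Local Notation leb := (@lebesgue_measure R).
Variables (N : vec -> R) (A : R -> mat) (f : R -> vec -> vec).
Variables (ysol : R -> R -> vec -> vec) (Phi : R -> R -> mat) (P : R -> mat).
Variables (K alpha mu K0 a eps Lf theta M delta : R).
Hypothesis hN : is_norm N.
Hypothesis cA : {within `[0%R, +oo[, continuous A}.
Hypothesis cf : {within [set p : R * vec | 0 <= p.1], continuous (fun p => f p.1 p.2)}.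
Hypothesis solP : forall t eta, 0 <= t ->
  is_solution A f (fun s => ysol s t eta) /\ ysol t t eta = eta.
Hypothesis PhiP : is_evolution_operator A Phi.
Hypothesis K_ge0 : 0 <= K.
Hypothesis alpha_gt0 : 0 < alpha.
Hypothesis mu_alpha : mu < alpha.
Hypothesis Pcomm : forall t s, 0 <= t -> 0 <= s -> P t *m Phi t s = Phi t s *m P s.
Hypothesis dich1 : forall t s w, 0 <= s -> s <= t ->
  N (Phi t s *m P s *m w) <= K * expR (- alpha * (t - s) + mu * s) * N w.
Hypothesis dich2 : forall t s w, 0 <= t -> t <= s ->
  N (Phi t s *m (1%:M - P s) *m w) <= K * expR (alpha * (t - s) + mu * s) * N w.
Hypothesis K0_ge0 : 0 <= K0.
Hypothesis growth : forall t s w, 0 <= t -> 0 <= s ->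
  N (Phi t s *m w) <= K0 * expR (a * `|t - s| + eps * s) * N w.
Hypothesis Lf_ge0 : 0 <= Lf.
Hypothesis theta_ge0 : 0 <= theta.
Hypothesis lipN : forall t y1 y2, 0 <= t ->
  N (f t y1 - f t y2) <= Lf * expR (- theta * t) * N (y1 - y2).
Hypothesis fbd : forall t y, 0 <= t -> N (f t y) <= M * expR (delta * t).
Hypothesis df : forall t x, 0 <= t -> differentiable (f t) x.
Hypothesis cdf : forall v : vec, {within [set p : R * vec | 0 <= p.1],
  continuous (fun p => d2 f p.1 p.2 v)}.
Hypothesis delta_mu : delta + mu < alpha.
Hypothesis eps_theta : eps < theta.
Hypothesis mu_eps : mu + eps <= theta.
Hypothesis rate_gt0 : 0 < theta + (alpha - a) - mu.

(** Net decay of increments of the integrand after [t]: [alpha - mu] from the dichotomy, [theta]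
    from (P1), less the growth [a] of the flow. *)
Let rate := theta + (alpha - a) - mu.
Let E := expR (Lf * K0 / (theta - eps)).
Let F (t s : R) (eta : vec) : vec := green Phi P t s *m f s (ysol s t eta).

(** One exponential for both branches: for [s <= t] the exponent is weakened from [- alpha] to
    [alpha], a loss that is bounded as long as [t] is. *)
Lemma green_norm (t s : R) w : 0 <= t -> 0 <= s ->
  N (green Phi P t s *m w) <= K * expR (alpha * (t - s) + mu * s) * N w.
Proof.
move=> t0 s0; have [N0 _ _ _] := hN; rewrite /green; case: (leP s t) => st.
  rewrite (le_trans (dich1 w s0 st))// ler_wpM2r// ler_wpM2l// ler_expR lerD2r.
  have : 0 <= alpha * (t - s) by rewrite mulr_ge0 ?subr_ge0// ltW.
  by rewrite mulNr; set b := _ * _; lra.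
by rewrite mulNmx is_normN// dich2// ltW.
Qed.

(** No regularity of [P] is assumed. Moved to the left, the projector is frozen at [P t], and the
    integrand becomes continuous in [s] on either side of [t]. *)
Lemma green_commute (t s : R) : 0 <= t -> 0 <= s -> green Phi P t s =
  if s <= t then P t *m Phi t s else - ((1%:M - P t) *m Phi t s).
Proof.
move=> t0 s0; rewrite /green Pcomm//; case: ifP => // _.
by rewrite mulmxBr mulmxBl mulmx1 mul1mx Pcomm.
Qed.

Lemma field_continuous (t : R) eta : 0 <= t ->
  {within `[0%R, +oo[, continuous (fun s => f s (ysol s t eta))}.
Proof.
move=> t0; have [[cy _] _] := @solP t eta t0.
apply/within_continuous_epsdelta => s sE e e0.
have s0 : 0 <= s by move: sE; rewrite /= in_itv/= andbT.
move/within_continuous_epsdelta: cf => /(_ (s, ysol s t eta) s0 e e0)[d d0 Hd].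
move/within_continuous_epsdelta: cy => /(_ s sE d d0)[d' d'0 Hd'].
exists (Num.min d d'); first by rewrite lt_min d0.
move=> r rE; rewrite lt_min => /andP[rd rd'].
apply: (Hd (r, ysol r t eta)); first by move: rE; rewrite /= in_itv/= andbT.
by rewrite /Num.Def.normr/= gt_max rd Hd'.
Qed.

Lemma evolution_field_continuous (Q : mat) (t : R) eta : 0 <= t ->
  {within `[0%R, +oo[, continuous (fun s => Q *m Phi t s *m f s (ysol s t eta))}.
Proof.
move=> t0; apply: within_continuous_mulmx; last exact: field_continuous.
apply: within_continuous_mulmx; last exact: (evolution_continuous2 cA PhiP t0).
exact: continuous_subspaceT (@cst_continuous _ _ Q).
Qed.

Lemma integrand_measurable (t : R) eta i : 0 <= t ->
  measurable_fun (`[0%R, +oo[%classic : set (measurableTypeR R))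
    (fun s => F t s eta i ord0).
Proof.
move=> t0.
have cont Q : {within `[0%R, +oo[, continuous
    (fun s => (Q *m Phi t s *m f s (ysol s t eta)) i ord0)}.
  exact: (@within_continuous_coord _ _ _ _ _ _ i ord0
    (@evolution_field_continuous Q t eta t0)).
have -> : (`[0%R, +oo[%classic : set (measurableTypeR R)) = `[0, t] `|` `]t, +oo[.
  by rewrite -itv_bndbnd_setU.
apply/measurable_funU => //; split.
- apply: (eq_measurable_fun (fun s => (P t *m Phi t s *m f s (ysol s t eta)) i ord0)).
    move=> s; rewrite inE/= in_itv/= => /andP[s0 st].
    by rewrite /F green_commute// st.
  apply: subspace_continuous_measurable_fun => //.
  apply: (continuous_subspaceW _ (cont (P t))).
  by move=> s; rewrite /= !in_itv/= => /andP[->].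
- apply: (eq_measurable_fun
    (fun s => (- (1%:M - P t) *m Phi t s *m f s (ysol s t eta)) i ord0)).
    move=> s; rewrite inE/= in_itv/= andbT => st.
    by rewrite /F green_commute ?(le_trans t0 (ltW st))// leNgt st/= mulNmx.
  apply: subspace_continuous_measurable_fun => //.
  apply: (continuous_subspaceW _ (cont (- (1%:M - P t)))).
  by move=> s; rewrite /= !in_itv/= !andbT => /ltW; exact: le_trans.
Qed.

Lemma integrand_integrable (t : R) eta : 0 <= t ->
  vintegrable `[0%R, +oo[ (fun s => F t s eta).
Proof.
move=> t0; have [D D0 DN] := is_norm_lower hN.
(* The Green function decays at rate [alpha - mu] and [f] grows at rate [delta]. *)
have k0 : 0 < alpha - mu - delta.
  by rewrite -addrA -opprD subr_gt0 (addrC mu).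
apply: (vintegrable_le (b := fun s => D * (K * expR (alpha * t) * M) *
    expR (- ((alpha - mu - delta) * s)))) => //.
- by move=> i; exact: integrand_measurable.
- exact: integrable_expR_tail.
- move=> s; rewrite /= in_itv/= andbT => s0.
  rewrite (le_trans (DN _))// -mulrA ler_pM2l// (le_trans (green_norm _ t0 s0))//.
  have Ks : 0 <= K * expR (alpha * (t - s) + mu * s) by rewrite mulr_ge0// expR_ge0.
  rewrite (le_trans (ler_wpM2l Ks (fbd _ s0)))//.
  rewrite le_eqVlt; apply/orP; left; apply/eqP.
  rewrite [LHS](_ : _ = K * M * (expR (alpha * (t - s) + mu * s) *
    expR (delta * s))); last by ring.
  rewrite [RHS](_ : _ = K * M * (expR (alpha * t) *
    expR (- ((alpha - mu - delta) * s)))); last by ring.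
  by rewrite -!expRD; congr (_ * expR _); ring.
Qed.

Lemma integrandB_norm (t s : R) eta1 eta2 : 0 <= t -> 0 <= s ->
  N (F t s eta1 - F t s eta2) <= K * expR (alpha * (t - s) + mu * s) *
    (Lf * expR (- theta * s) * N (ysol s t eta1 - ysol s t eta2)).
Proof.
move=> t0 s0; rewrite /F -mulmxBr (le_trans (green_norm _ t0 s0))//.
by rewrite ler_wpM2l ?mulr_ge0 ?expR_ge0// lipN.
Qed.

(** The exponents [alpha * (t - s) + mu * s], [- theta * s] and [a * (s - t) + eps * t] of the Green
    function, of (P1) and of the flow add up to [(alpha - a + eps) * t - rate * s]. *)
Lemma integrandB_norm_after (t s : R) eta1 eta2 : 0 <= t -> t <= s ->
  N (F t s eta1 - F t s eta2) <=
  K * Lf * K0 * E * expR ((alpha - a + eps) * t) * N (eta1 - eta2) *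
  expR (- (rate * s)).
Proof.
move=> t0 ts; have s0 := le_trans t0 ts.
rewrite (le_trans (integrandB_norm _ _ t0 s0))//.
have G := flow_growth hN cA solP PhiP K0_ge0 growth Lf_ge0 lipN eps_theta
  eta1 eta2 t0 ts.
have C1 : 0 <= K * expR (alpha * (t - s) + mu * s) by rewrite mulr_ge0// expR_ge0.
have C2 : 0 <= Lf * expR (- theta * s) by rewrite mulr_ge0// expR_ge0.
rewrite (le_trans (ler_wpM2l C1 (ler_wpM2l C2 G)))//.
rewrite le_eqVlt; apply/orP; left; apply/eqP; rewrite -/E.
rewrite [LHS](_ : _ = K * Lf * K0 * E * N (eta1 - eta2) *
  (expR (alpha * (t - s) + mu * s) * expR (- theta * s) *
   expR (a * (s - t) + eps * t))); last by ring.
rewrite [RHS](_ : _ = K * Lf * K0 * E * N (eta1 - eta2) *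
  (expR ((alpha - a + eps) * t) * expR (- (rate * s)))); last by ring.
by rewrite -!expRD /rate; congr (_ * expR _); ring.
Qed.

Lemma lipf_mx : exists2 Lc, 0 <= Lc &
  forall t y1 y2, 0 <= t -> `|f t y1 - f t y2| <= Lc * `|y1 - y2|.
Proof.
have [C C0 NC] := is_norm_upper hN; have [D D0 DN] := is_norm_lower hN.
exists (D * (Lf * C)); first by rewrite !mulr_ge0// ltW.
move=> t y1 y2 t0; rewrite (le_trans (DN _))// -mulrA ler_pM2l//.
rewrite (le_trans (lipN _ _ t0))// -[leRHS]mulrA.
have : Lf * expR (- theta * t) <= Lf.
  by rewrite ler_piMr// -expR0 ler_expR mulNr oppr_le0 mulr_ge0.
have [N0 _ _ _] := hN => e1.
by rewrite (le_trans (ler_wpM2r (N0 _) e1))// ler_wpM2l.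
Qed.

Lemma flow_lipschitzN (T : R) : exists2 C, 0 <= C &
  forall s t eta1 eta2, 0 <= s <= T -> 0 <= t <= T ->
  N (ysol s t eta1 - ysol s t eta2) <= C * N (eta1 - eta2).
Proof.
have [C C0 NC] := is_norm_upper hN; have [D D0 DN] := is_norm_lower hN.
have [Lc Lc0 lipf] := lipf_mx; have [B B0 HB] := flow_lipschitz cA solP Lc0 lipf T.
exists (C * (B * D)); first by rewrite !mulr_ge0// ltW.
move=> s t eta1 eta2 sT tT; rewrite (le_trans (NC _))// -mulrA ler_pM2l//.
by rewrite (le_trans (HB s t eta1 eta2 sT tT))// -mulrA ler_pM2l.
Qed.

Lemma integrandB_norm_before (T : R) : exists2 C, 0 <= C &
  forall t s eta1 eta2, 0 <= t <= T -> 0 <= s <= t ->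
  N (F t s eta1 - F t s eta2) <= C * N (eta1 - eta2).
Proof.
have [C C0 HC] := flow_lipschitzN T; have [N0 _ _ _] := hN.
exists (K * expR (alpha * T) * (Lf * C)); first by rewrite !mulr_ge0// expR_ge0.
move=> t s eta1 eta2 /andP[t0 tT] /andP[s0 st].
rewrite (le_trans (integrandB_norm _ _ t0 s0))// -[leRHS]mulrA.
rewrite ler_pM ?mulr_ge0 ?expR_ge0//.
  rewrite ler_wpM2l// ler_expR.
  have e1 : 0 <= alpha * (T - t) by rewrite mulr_ge0 ?subr_ge0// ltW.
  have e2 : 0 <= (alpha - mu) * s by rewrite mulr_ge0// subr_ge0 ltW.
  by move: e1 e2; rewrite !mulrBr mulrBl; lra.
rewrite -[leRHS]mulrA -[leLHS]mulrA ler_wpM2l// -[leRHS]mul1r ler_pM ?expR_ge0//.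
  by rewrite -expR0 ler_expR mulNr oppr_le0 mulr_ge0.
by apply: HC; rewrite ?t0 ?s0// (le_trans st tT).
Qed.

(** Before [t] no decay is available, but there [expR (rate * (t - s))] is at least 1, so a factor
    [expR (rate * t)] extends the exponential bound to all [s]. *)
Lemma integrandB_decay (t : R) : 0 <= t -> exists2 C, 0 <= C &
  forall s eta1 eta2, 0 <= s ->
  `|F t s eta1 - F t s eta2| <= C * `|eta1 - eta2| * expR (- (rate * s)).
Proof.
move=> t0; have [C C0 NC] := is_norm_upper hN; have [D D0 DN] := is_norm_lower hN.
have [B B0 HB] := integrandB_norm_before t.
have [N0 _ _ _] := hN.
have [G [G0 GE]] : exists G : R, 0 <= G /\
    G = K * Lf * K0 * E * expR ((alpha - a + eps) * t).
  by exists (K * Lf * K0 * E * expR ((alpha - a + eps) * t));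
    rewrite !mulr_ge0// expR_ge0.
exists (D * ((B * expR (rate * t) + G) * C)).
  by rewrite !mulr_ge0 ?addr_ge0 ?mulr_ge0 ?expR_ge0// ltW.
move=> s eta1 eta2 s0; rewrite (le_trans (DN _))// -!mulrA ler_pM2l//.
have Bt : 0 <= B * expR (rate * t) by rewrite mulr_ge0// expR_ge0.
have H : N (F t s eta1 - F t s eta2) <=
    (B * expR (rate * t) + G) * (N (eta1 - eta2) * expR (- (rate * s))).
  have X0 : 0 <= N (eta1 - eta2) * expR (- (rate * s)) by rewrite mulr_ge0// expR_ge0.
  have [st|ts] := leP s t.
    rewrite (@le_trans _ _ (B * N (eta1 - eta2)))//.
      by apply: HB; rewrite ?t0 ?s0/=.
    rewrite mulrDl ler_wpDr// ?mulr_ge0// -mulrA ler_wpM2l//.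
    rewrite mulrCA ler_peMr// -expRD -expR0 ler_expR -mulrBr.
    by rewrite mulr_ge0 ?(ltW rate_gt0)// subr_ge0.
  rewrite (le_trans (integrandB_norm_after _ _ t0 (ltW ts)))// -GE -mulrA.
  by rewrite ler_wpM2r// lerDr.
rewrite (le_trans H)// ler_wpM2l ?addr_ge0// mulrA ler_wpM2r ?expR_ge0//.
Qed.

(** The difference of quotients is dominated by [e2 * expR (- (k * s))], whose integral is [e]. Up
    to [T] the quotients of the field are uniformly close; beyond [T] half of the decay rate buys
    smallness and the other half integrability. *)
Lemma conjugacy_integral_cauchy_dquot (t : R) : 0 <= t ->
  cauchy_dquot (fun eta => integral0oo (fun s => F t s eta)).
Proof.
move=> t0 x v e e0.
have mD : measurable (`[0%R, +oo[%classic : set (measurableTypeR R)).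
  exact: measurable_itv.
have [CL CL0 HL] := integrandB_decay t0.
have [C C0 NC] := is_norm_upper hN; have [D D0 DN] := is_norm_lower hN.
have [N0 _ _ _] := hN.
have [k [k0 kE]] : exists k : R, 0 < k /\ k + k = rate.
  by exists (rate / 2); rewrite divr_gt0// -splitr.
have [e2 [e20 e2E]] : exists e2 : R, 0 < e2 /\ e2 / k = e.
  by exists (e * k); rewrite mulr_gt0// mulfK// gt_eqF.
have b0 : 0 < 2 * (CL * `|v|) + 1 by rewrite ltr_wpDl// !mulr_ge0.
have [T0 HT0] := expR_linear_small k0 (divr_gt0 e20 b0).
(* [T >= t] because the Gronwall comparison of quotients starts at time [t], which must lie in
   [[0, T]]. *)
pose T := Num.max T0 t.
have tT : 0 <= t <= T by rewrite t0 le_max lexx orbT.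
have [Cg [Cg0 HCg]] : exists Cg : R, 0 <= Cg /\
    forall (s : R) (w : vec), 0 <= s -> `|green Phi P t s *m w| <= Cg * `|w|.
  exists (D * (K * expR (alpha * t) * C)); split.
    by rewrite !mulr_ge0 ?expR_ge0// ltW.
  move=> s w s0; rewrite (le_trans (DN _))// -[leRHS]mulrA ler_pM2l//.
  rewrite (le_trans (green_norm _ t0 s0))// -[leRHS]mulrA.
  rewrite ler_pM ?mulr_ge0 ?expR_ge0// ler_wpM2l// ler_expR.
  have : 0 <= (alpha - mu) * s by rewrite mulr_ge0// subr_ge0 ltW.
  by rewrite mulrBr mulrBl; set b1 := _ * _; set b2 := _ * _; set b3 := _ * _; lra.
have Cg1 : 0 < Cg + 1 by rewrite ltr_wpDl.
(* [e2 * expR (- (k * T))] is the least value of the dominating function on [[0, T]]; [Cg + 1]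
   compensates for the Green function. *)
have e30 : 0 < e2 * expR (- (k * T)) / (Cg + 1) by rewrite divr_gt0// mulr_gt0// expR_gt0.
have [Lc Lc0 lipf] := lipf_mx.
have [d d0 Hd] := field_quot_cauchy cA solP Lc0 lipf df cdf x v tT e30.
exists d => // x1 x2 h1 h2 x1d x2d h10 h20 h1d h2d.
have Fint eta := @integrand_integrable t eta t0.
have qint y h : vintegrable `[0%R, +oo[ (fun s => dquot (F t s) v y h).
  by apply: vintegrableZ => //; apply: vintegrableB => //; exact: Fint.
have quotE y h : dquot (fun eta => integral0oo (fun s => F t s eta)) v y h =
    vintegral `[0%R, +oo[ (fun s => dquot (F t s) v y h).
  rewrite vintegralZ//; last by apply: vintegrableB => //; exact: Fint.
  by rewrite vintegralB//; exact: Fint.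
rewrite !quotE -vintegralB//.
have eE : e = \int[leb]_(s in `[0%R, +oo[) (e2 * expR (- (k * s))).
  by rewrite Rintegral_expR_tail// mulr0 oppr0 expR0 mul1r.
rewrite [leRHS]eE; apply: vintegral_norm_le => //.
- exact: vintegrableB.
- exact: integrable_expR_tail.
move=> s; rewrite /= in_itv/= andbT => s0.
have dqL y h : h != 0 -> `|dquot (F t s) v y h| <= CL * `|v| * expR (- (rate * s)).
  move=> h0; rewrite /dquot normrZ normfV mulrC ler_pdivrMr ?normr_gt0//.
  rewrite (le_trans (HL s _ _ s0))// addrC addKr normrZ.
  by rewrite le_eqVlt; apply/orP; left; apply/eqP; ring.
have [sT|/ltW Ts] := leP s T.
  have -> : dquot (F t s) v x1 h1 - dquot (F t s) v x2 h2 = green Phi P t s *m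
      (dquot (f s \o ysol s t) v x1 h1 - dquot (f s \o ysol s t) v x2 h2).
    by rewrite mulmxBr /dquot -!scalemxAr !mulmxBr.
  rewrite (le_trans (HCg _ _ s0))//.
  have sT' : 0 <= s <= T by rewrite s0.
  have H := Hd x1 x2 h1 h2 x1d x2d h10 h20 h1d h2d s sT'.
  rewrite (le_trans (ler_wpM2l Cg0 H))// mulrCA.
  rewrite (@le_trans _ _ (e2 * expR (- (k * T))))//.
    rewrite ler_piMr ?mulr_ge0 ?expR_ge0 ?(ltW e20)//.
    by rewrite ler_pdivrMr// mul1r lerDl.
  by rewrite ler_pM2l// ler_expR lerN2 ler_pM2l.
have T0s : T0 <= s by rewrite (le_trans _ Ts)// le_max lexx.
rewrite (le_trans (ler_normB _ _))// (le_trans (lerD (dqL x1 h1 h10) (dqL x2 h2 h20)))//.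
rewrite -kE mulrDl opprD expRD.
have := HT0 s T0s; rewrite ler_pdivlMr//.
have := expR_gt0 (- (k * s)); move: (expR _) => u u0 H.
have cv0 : 0 <= CL * `|v| by rewrite mulr_ge0.
rewrite -mulrDl mulrA ler_pM2r//.
move: H; rewrite mulrDr mulr1 => H; rewrite (le_trans _ H)//.
rewrite (_ : _ * u = u * (2 * (CL * `|v|))); last by ring.
by rewrite lerDl ltW.
Qed.

(* Splitting at [t]: the part before [t] has a Lipschitz constant of order [t],
   the part after [t] one of at most [K Lf K0 E / rate <= 1 / c]. *)
Lemma conjugacy_integral_lipschitz : exists2 C, 0 <= C &
  forall t eta1 eta2, 0 <= t <= 1 ->
  N (integral0oo (fun s => F t s eta1) - integral0oo (fun s => F t s eta2)) <=
  (K * Lf * K0 * E / rate + C * t) * N (eta1 - eta2).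
Proof.
have [Cb Cb0 HCb] := integrandB_norm_before 1; exists Cb => // t eta1 eta2 t01.
have t0 : 0 <= t by case/andP: t01.
have [C C0 NC] := is_norm_upper hN; have [N0 NI NZ ND] := hN.
have [CL CL0 HL] := integrandB_decay t0.
have mD : measurable (`[0%R, +oo[%classic : set (measurableTypeR R)).
  exact: measurable_itv.
pose H s := F t s eta1 - F t s eta2.
have Fint eta := @integrand_integrable t eta t0.
have iH : vintegrable `[0%R, +oo[ H by apply: vintegrableB => //; exact: Fint.
have -> : integral0oo (fun s => F t s eta1) - integral0oo (fun s => F t s eta2) =
    vintegral `[0%R, +oo[ H by rewrite vintegralB//; exact: Fint.
apply/ler_addgt0Pr => e e0.
pose X := N (eta1 - eta2); have X0 : 0 <= X by exact: N0.
have b0 : 0 < C * (CL * `|eta1 - eta2|) / rate + 1.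
  by rewrite ltr_wpDl// divr_ge0 ?(ltW rate_gt0)// !mulr_ge0// ltW.
have [T0 HT0] := expR_linear_small rate_gt0 (divr_gt0 e0 b0).
(* The mean value estimate in [N] covers bounded intervals, so the half line is also cut at a time
   [T] beyond which the tail costs at most [e]. *)
pose T := Num.max T0 t.
have tT : t <= T by rewrite le_max lexx orbT.
have TT0 : T0 <= T by rewrite le_max lexx.
rewrite (@vintegral_split _ _ _ _ t)// ?bnd_simp//.
have iHt : vintegrable `]t, +oo[ H.
  move=> i; apply: integrableS (iH i) => //.
  by move=> s; rewrite /= !in_itv/= !andbT => /ltW; exact: le_trans.
rewrite (@vintegral_split _ _ (BRight t) _ T)// ?bnd_simp//.
have cont (Q : mat) : {within `[0%R, +oo[, continuous (fun s =>
    Q *m Phi t s *m f s (ysol s t eta1) - Q *m Phi t s *m f s (ysol s t eta2))}.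
  by apply: within_continuous_sub; exact: evolution_field_continuous.
have I1 : N (vintegral `[0, t] H) <= Cb * t * X.
  pose H1 s := P t *m Phi t s *m f s (ysol s t eta1) -
               P t *m Phi t s *m f s (ysol s t eta2).
  have HH1 s : 0 <= s -> s <= t -> H s = H1 s.
    by move=> s0 st; rewrite /H /F green_commute// st.
  have -> : vintegral `[0, t] H = vintegral `[0, t] H1.
    by apply: eq_vintegral => s; rewrite /= in_itv/= => /andP[]; exact: HH1.
  have := @vintegral_segment_norm _ _ N H1 (fun r => r * (Cb * X)) (fun=> Cb * X)
    0 t hN t0 (continuous_half_line_segment (cont (P t))).
  rewrite mul0r subr0 mulrA (mulrC t); apply.
    move=> s; apply/is_derive_epsdelta => e1 e10; exists 1 => // h _.
    rewrite /GRing.scale/= mulrDl (addrC (s * _)) addrK subrr normr0.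
    by rewrite mulr_ge0// ltW.
  move=> s /andP[/ltW s0 /ltW st]; rewrite -HH1//.
  by apply: HCb => //; rewrite s0.
pose c := K * Lf * K0 * E * expR ((alpha - a + eps) * t) * X.
have c_ge0 : 0 <= c by rewrite !mulr_ge0// expR_ge0.
have I2 : N (vintegral `]t, T] H) <= K * Lf * K0 * E / rate * X.
  pose H2 s := - (1%:M - P t) *m Phi t s *m f s (ysol s t eta1) -
               - (1%:M - P t) *m Phi t s *m f s (ysol s t eta2).
  have HH2 s : t < s -> H s = H2 s.
    move=> ts; rewrite /H /F green_commute ?(le_trans t0 (ltW ts))//.
    by rewrite leNgt ts/= /H2 !mulNmx.
  have c2 : {within `[t, T], continuous H2}.
    apply: (continuous_subspaceW _ (cont (- (1%:M - P t)))).
    by move=> s; rewrite /= !in_itv/= andbT => /andP[/(le_trans t0)].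
  (* The Green function jumps at [t]; [H2] extends the values of [H] after [t] continuously to the
     closed interval, and a single point is negligible. *)
  have -> : vintegral `]t, T] H = vintegral `[t, T] H2.
    rewrite (@eq_vintegral _ _ `]t, T] H H2); last first.
      by move=> s; rewrite /= in_itv/= => /andP[/HH2].
    apply/colP => i; rewrite !mxE Rintegral_itv_obnd_cbnd//.
    have i2 : leb.-integrable `[t, T] (EFin \o (fun s => H2 s i ord0)).
      apply: continuous_compact_integrable; first exact: segment_compact.
      exact: (@within_continuous_coord _ _ _ _ _ _ i ord0 c2).
    apply: integrableS i2 => //.
    by move=> s; rewrite /= !in_itv/= => /andP[/ltW -> ->].
  pose B s := - (c / rate) * expR (- (rate * s)).
  have dB (s : R) : is_derive s 1 B (c * expR (- (rate * s))).
    have := expR_linear_derive rate (- (c / rate)) s.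
    have -> : - (rate * - (c / rate)) = c.
      by rewrite mulrN opprK mulrC divfK// gt_eqF.
    by [].
  have := @vintegral_segment_norm _ _ N H2 B _ t T hN tT c2 dB.
  move=> /(_ _)/le_trans; apply.
    move=> s /andP[ts sT]; rewrite -HH2//.
    exact: (integrandB_norm_after _ _ t0 (ltW ts)).
  rewrite /B !mulNr opprK addrC.
  rewrite (@le_trans _ _ (c / rate * expR (- (rate * t))))//.
    by rewrite lerBlDr lerDl mulr_ge0 ?expR_ge0// divr_ge0// ltW.
  rewrite /c [leLHS](_ : _ = K * Lf * K0 * E / rate * X *
    (expR ((alpha - a + eps) * t) * expR (- (rate * t)))); last by ring.
  rewrite ler_piMr ?mulr_ge0 ?invr_ge0 ?(ltW rate_gt0) ?expR_ge0//.
  (* [alpha - a + eps - rate] equals [mu + eps - theta], which is at most 0. *)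
  rewrite -expRD -expR0 ler_expR -mulrBl mulr_le0_ge0// /rate.
  rewrite (_ : _ - _ = mu + eps - theta); last by ring.
  by rewrite subr_le0.
have I3 : N (vintegral `]T, +oo[ H) <= e.
  have iHT : vintegrable `]T, +oo[ H.
    move=> i; apply: integrableS (iHt i) => //.
    by move=> s; rewrite /= !in_itv/= !andbT; exact: le_lt_trans.
  pose b s := CL * `|eta1 - eta2| * expR (- (rate * s)).
  have ib : leb.-integrable `[T, +oo[ (EFin \o b) by exact: integrable_expR_tail.
  have ib' : leb.-integrable `]T, +oo[ (EFin \o b).
    apply: integrableS ib => //.
    by move=> s; rewrite /= !in_itv/= !andbT; exact: ltW.
  have := @vintegral_norm_le _ _ `]T, +oo[ H b (measurable_itv _) iHT ib'.
  rewrite Rintegral_itv_obnd_cbnd// Rintegral_expR_tail// => H3.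
  rewrite (le_trans (NC _))// (le_trans (ler_wpM2l (ltW C0) (H3 _)))//.
    move=> s; rewrite /= in_itv/= andbT => Ts; apply: HL.
    by rewrite (le_trans t0)// (le_trans tT)// ltW.
  have := HT0 T TT0; rewrite ler_pdivlMr//; apply: le_trans.
  rewrite mulrDr mulr1 ler_wpDr ?expR_ge0//.
  by rewrite le_eqVlt; apply/orP; left; apply/eqP; ring.
rewrite (le_trans (ND _ _))// mulrDl -/X -addrA addrCA lerD//.
by rewrite (le_trans (ND _ _))// lerD.
Qed.

Lemma conjugacy_C1_diffeo (c : R) : 2 < c ->
  K * Lf * K0 * E / rate <= 1 / c ->
  exists2 tc : R, 0 < tc &
  forall t, 0 <= t -> t < tc -> C1_diffeo (Gmap Phi P f ysol t).
Proof.
move=> c2 hc; have [C C0 HC] := conjugacy_integral_lipschitz.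
have C10 : 0 < 2 * (C + 1) by rewrite mulr_gt0// ltr_wpDl.
(* Up to time 1 the constant [C] is valid; below [1 / (2 * (C + 1))] the part before [t] contributes
   at most [1 / 2], and [c > 2] puts the rest strictly below [1 / 2]. *)
exists (Num.min 1 (2 * (C + 1))^-1); first by rewrite lt_min ltr01 invr_gt0.
move=> t t0; rewrite lt_min => /andP[t1 tC].
pose q := K * Lf * K0 * E / rate + C * t.
have q0 : 0 <= q.
  rewrite addr_ge0 ?mulr_ge0// ?expR_ge0// invr_ge0; exact: ltW.
have c0 : 0 < c by rewrite (lt_trans _ c2).
have q1 : q < 1.
  have h1 : 1 / c < 1 / 2 by rewrite ltr_pM2l// ltf_pV2 ?posrE.
  have h2 : C * t <= 1 / 2.
    rewrite (@le_trans _ _ (C * (2 * (C + 1))^-1))//.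
      by rewrite ler_wpM2l// ltW.
    rewrite ler_pdivrMr// mulrA divfK// mulrC; lra.
  by move: hc h1 h2; rewrite /q; move: (_ / rate) (C * t) (1 / c) => u w z; lra.
apply: (@id_sub_contraction_C1_diffeo _ _ N q _ hN q0 q1).
  by move=> x y; apply: HC; rewrite t0 ltW.
exact: conjugacy_integral_cauchy_dquot.
Qed.

End Conjugacy.

Theorem theorem2 (R : realType) (n : nat)
  (nrm : 'cV[R]_n -> R)
  (A : R -> 'M[R]_n) (f : R -> 'cV[R]_n -> 'cV[R]_n)
  (ysol : R -> R -> 'cV[R]_n -> 'cV[R]_n)
  (Phi : R -> R -> 'M[R]_n) (P : R -> 'M[R]_n)
  (K alpha mu K0 a eps Lf theta M delta b c : R) :
  (* standing setting *)
  is_norm nrm ->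
  {within `[0%R, +oo[, continuous A} ->
  {within [set p : R * 'cV[R]_n | 0 <= p.1], continuous (fun p => f p.1 p.2)} ->
  (forall t eta, 0 <= t -> is_solution A f (fun s => ysol s t eta) /\ ysol t t eta = eta) ->
  (forall t eta (z : R -> 'cV[R]_n), 0 <= t -> is_solution A f z -> z t = eta ->
     forall s, 0 <= s -> z s = ysol s t eta) ->
  is_evolution_operator A Phi ->
  (* nonuniform exponential dichotomy (K, alpha, mu) with projector P *)
  1 <= K -> 0 < alpha -> 0 <= mu -> mu < alpha ->
  (forall t, 0 <= t -> P t *m P t = P t) ->
  (forall t s, 0 <= t -> 0 <= s -> P t *m Phi t s = Phi t s *m P s) ->
  (forall t s, 0 <= s -> s <= t ->
     opnorm nrm (Phi t s *m P s) <= K * expR (- alpha * (t - s) + mu * s)) ->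
  (forall t s, 0 <= t -> t <= s ->
     opnorm nrm (Phi t s *m (1%:M - P s)) <= K * expR (alpha * (t - s) + mu * s)) ->
  (* nonuniform bounded growth (K0, a, eps) *)
  1 <= K0 -> 0 < a -> 0 <= eps ->
  (forall t s, 0 <= t -> 0 <= s ->
     opnorm nrm (Phi t s) <= K0 * expR (a * `|t - s| + eps * s)) ->
  (* (P1) *)
  0 < Lf -> 0 <= theta ->
  (forall t y1 y2, 0 <= t ->
     nrm (f t y1 - f t y2) <= Lf * expR (- theta * t) * nrm (y1 - y2)) ->
  (* (P2) *)
  0 < M -> 0 <= delta ->
  (forall t y, 0 <= t -> nrm (f t y) <= M * expR (delta * t)) ->
  (* (P3) *)
  (forall t x, 0 <= t -> differentiable (f t) x) ->
  (forall v : 'cV[R]_n,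
     {within [set p : R * 'cV[R]_n | 0 <= p.1], continuous (fun p => d2 f p.1 p.2 v)}) ->
  (* conditions on b *)
  0 < b ->
  delta + mu < Num.min b alpha ->
  mu <= theta -> eps < theta ->
  0 < alpha + mu - theta + b -> 0 < alpha - mu + theta - b ->
  K * Lf / (alpha + mu - theta + b) + K * Lf / (alpha - mu + theta - b) < 1 ->
  (* additional conditions *)
  Num.max (mu + alpha - a) (mu - (alpha - a)) < theta ->
  mu + eps <= theta ->
  2 < c ->
  K * Lf * K0 * expR (Lf * K0 / (theta - eps)) *
    Num.max (1 / (theta - (alpha - a) - mu)) (1 / (theta + (alpha - a) - mu)) <= 1 / c ->
  exists tc : \bar R, (0 < tc)%E /\
    forall t : R, 0 <= t -> (t%:E < tc)%E -> C1_diffeo (Gmap Phi P f ysol t).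
Proof.
move=> hN cA cf solP _ PhiP K1 alpha0 _ mu_alpha _ Pcomm dich1 dich2 K01 _ _ growth.
move=> Lf0 theta0 lipf _ _ fbd df cdf _ delta_mu _ eps_theta _ _ _ max_theta mu_eps.
move=> c2 hc.
have [N0 _ _ _] := hN.
have K_ge0 : 0 <= K by exact: le_trans K1.
have K0_ge0 : 0 <= K0 by exact: le_trans K01.
(* The second entry of the maximum, [mu - (alpha - a) < theta], is positivity of the decay rate. *)
have rate_gt0 : 0 < theta + (alpha - a) - mu.
  move: max_theta; rewrite gt_max => /andP[_].
  by rewrite ltrBlDr subr_gt0.
suff [tc tc0 Htc] : exists2 tc : R, 0 < tc &
    forall t, 0 <= t -> t < tc -> C1_diffeo (Gmap Phi P f ysol t).
  by exists tc%:E; split=> [|t t0]; rewrite lte_fin//; exact: Htc.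
apply: (@conjugacy_C1_diffeo _ _ nrm A f ysol Phi P K alpha mu K0 a eps Lf theta
  M delta hN cA cf solP PhiP K_ge0 alpha0 mu_alpha Pcomm _ _ K0_ge0 _ (ltW Lf0)
  theta0 lipf fbd df cdf _ eps_theta mu_eps rate_gt0 c c2).
- move=> t s w s0 st; rewrite (le_trans (opnorm_bound _ _ hN))// ler_wpM2r//.
  exact: dich1.
- move=> t s w t0 ts; rewrite (le_trans (opnorm_bound _ _ hN))// ler_wpM2r//.
  exact: dich2.
- move=> t s w t0 s0; rewrite (le_trans (opnorm_bound _ _ hN))// ler_wpM2r//.
  exact: growth.
- by move: delta_mu; rewrite lt_min => /andP[].
- apply: le_trans hc; rewrite ler_wpM2l ?mulr_ge0 ?expR_ge0 ?(ltW Lf0)//.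
  by rewrite le_max !div1r lexx orbT.
Qed.
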